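(* Let $R$ be a principal ideal domain and let $A_*$, $B_*$ be chain complexes of $R$-modules such that the complex $A_**_RB_*$ is acyclic. Fix weak splittings $\mathfrak g^A_*$ of $A_*$ and $\mathfrak g^B_*$ of $B_*$. For $a\in H_i(A_* )$, $b\in H_j(B_* )$, $r\in R$ with $ar=0$, $rb=0$, choose $\hat a\in\mathcal Z^A_i$ and $\hat b\in\mathcal Z^B_j$ with $\hat\gamma^A_i(\hat a)=a$, $\hat\gamma^B_j(\hat b)=b$ and form the cycle $$M(\hat a,r,\hat b)=(-1)^{i+1}\,\gamma^A_i(\hat a)\otimes\theta^B_j(r\hat b)+\theta^A_i(\hat a r)\otimes\gamma^B_j(\hat b)\in A_*\otimes_RB_* .$$ Then taking the homology class of $M(\hat a,r,\hat b)$ yields an $R$-module map $$\mu^{\mathfrak g^A_*,\mathfrak g^B_*}_{i,j}\colon H_i(A_* )*_RH_j(B_* )\to H_{i+j+1}(A_*\otimes_RB_* ),\qquad \langle a,r,b\rangle\mapsto[M(\hat a,r,\hat b)],$$ which splits the Künneth formula at $(i,j)$.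
   Context: Chain complexes are indexed by $\mathbb{Z}$, differential of degree $-1$; $\partial(x\otimes y)=\partial x\otimes y+(-1)^{|x|}x\otimes\partial y$. $\mathbf Z_n(C_* )$ and $\mathbf B_n(C_* )$ denote cycles and boundaries. $A_**_RB_*$ is the complex with degree-$n$ part $\bigoplus_{i+j=n}A_i*_RB_j$, defined like the tensor product complex. Weak splitting: a weak splitting $\mathfrak g^A_*$ of a complex $A_*$ consists, for each $n$, of a free resolution $0\to\mathcal B^A_n\subset\mathcal Z^A_n\xrightarrow{\hat\gamma^A_n}H_n(A_* )\to0$ and $R$-module maps $\gamma^A_n\colon\mathcal Z^A_n\to\mathbf Z_n(A_* )$, $\theta^A_n\colon\mathcal B^A_n\to A_{n+1}$ such that $[\gamma^A_n(z)]=\hat\gamma^A_n(z)$ for $z\in\mathcal Z^A_n$ and $\partial^A\theta^A_n(w)=\gamma^A_n(w)$ for $w\in\mathcal B^A_n$. Since $ar=0$, $\hat a r\in\mathcal B^A_i$, and similarly $r\hat b\in\mathcal B^B_j$. The class $[M(\hat a,r,\hat b)]$ does not depend on the lifts $\hat a,\hat b$. Torsion product: $M*_RN=\mathrm{Tor}_1^R(M,N)$. For a free resolution $0\to K\to F\to M\to0$, $M*_RN=\ker(K\otimes_RN\to F\otimes_RN)$; for $ar=0$, $rb=0$ the elementary tor $\langle a,r,b\rangle$ is $(\tilde a r)\otimes b$ with $\tilde a\in F$ a lift of $a$. Elementary tors generate $M*_RN$ additively. Künneth formula: when $A_**_RB_*$ is acyclic there is a natural, split short exact sequence $0\to\bigoplus_{i+j=n}H_i(A_*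 )\otimes_RH_j(B_* )\xrightarrow{\times}H_n(A_*\otimes_RB_* )\xrightarrow{\beta}\bigoplus_{i+j=n-1}H_i(A_* )*_RH_j(B_* )\to0$, $[x]\times[y]=[x\otimes y]$. For free complexes $\beta$ is induced by $\partial^A\otimes1$, with values in $\bigoplus\ker(\mathbf B_i(A_* )\otimes H_j(B_* )\to\mathbf Z_i(A_* )\otimes H_j(B_* ))=\bigoplus H_i(A_* )*_RH_j(B_* )$; in general $\beta$ is transported from free complexes along quasi-isomorphisms $F^A_*\to A_*$, $F^B_*\to B_*$ with $F^A_*,F^B_*$ free (their tensor product is then a quasi-isomorphism). $\beta_{k,l}$ is $\beta$ followed by projection to $H_k(A_* )*_RH_l(B_* )$. A map $\sigma\colon H_i(A_* )*_RH_j(B_* )\to H_{i+j+1}(A_*\otimes_RB_* )$ splits the Künneth formula at $(i,j)$ if $\beta_{k,l}\circ\sigma$ is the identity for $(k,l)=(i,j)$ and $0$ otherwise. *)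

(* Defs.v *)
From HB Require Import structures.
From mathcomp Require Import all_boot all_algebra.
From mathcomp Require Import boolp.
From mathcomp Require Import freeg.
From mathcomp Require Import zify.

Set Implicit Arguments.
Unset Strict Implicit.
Unset Printing Implicit Defensive.

Import GRing.Theory.
Local Open Scope ring_scope.
Local Open Scope quotient_scope.

Definition principal_ideal_ring (R : comNzRingType) : Prop :=
  forall I : {pred R^o}, submod_closed I ->
    exists d : R, forall x, x \in I <-> exists c, x = c * d.

Definition mk_linear (R : comNzRingType) (U V : lmodType R) (f : U -> V)
    (hf : linear f) : {linear U -> V} :=
  HB.pack f (GRing.isLinear.Build R U V *:%R f hf).

Definition lin_id (R : comNzRingType) (V : lmodType R) : {linear V -> V} :=
  idfun.

Record submodule (R : comNzRingType) (V : lmodType R) := Submodule {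
  smem :> {pred V};
  smemP : submod_closed smem
}.

HB.instance Definition _ (R : comNzRingType) (V : lmodType R)
    (S : submodule V) :=
  GRing.isSubmodClosed.Build R V (smem S) (smemP S).

Section Submodule.
Variables (R : comNzRingType) (V : lmodType R) (S : submodule V).

Definition subm_type : Type := {x : V | x \in smem S}.
HB.instance Definition _ := SubType.on subm_type.
HB.instance Definition _ := [Choice of subm_type by <:].
HB.instance Definition _ := [SubChoice_isSubLmodule of subm_type by <:].
Definition subm : lmodType R := subm_type.

Fact sincl_linear : linear (val : subm -> V).
Proof. by move=> a x y; rewrite linearP. Qed.
Definition sincl : {linear subm -> V} := mk_linear sincl_linear.

Lemma sincl_in (x : subm) : sincl x \in smem S.
Proof. exact: valP. Qed.

Lemma sincl_inj : injective sincl.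
Proof. exact: val_inj. Qed.

Section Corestriction.
Variables (U : lmodType R) (f : {linear U -> V}).
Hypothesis fS : forall u, f u \in smem S.
Definition corestr_fun (u : U) : subm := exist _ (f u) (fS u).
Fact corestr_linear : linear corestr_fun.
Proof. by move=> a x y; apply: sincl_inj; rewrite [LHS]linearP. Qed.
Definition corestr : {linear U -> subm} := mk_linear corestr_linear.
Lemma corestrE u : sincl (corestr u) = f u. Proof. by []. Qed.
End Corestriction.

Definition quotm_type : Type := Quotient.quot (smem S).
HB.instance Definition _ := GRing.Zmodule.on quotm_type.
Definition qpi_fun (x : V) : quotm_type := \pi_(Quotient.quot (smem S)) x.

Lemma qpi_funB : {morph qpi_fun : x y / x - y}.
Proof. by move=> x y; exact: raddfB. Qed.

Lemma qpi_eqE x y : (qpi_fun x = qpi_fun y) <-> (x - y \in smem S).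
Proof. by rewrite Quotient.idealrBE; split=> [/eqP|] //; move/eqP. Qed.

Definition qscale (a : R) (x : quotm_type) : quotm_type :=
  qpi_fun (a *: repr (x : Quotient.quot (smem S))).

Lemma qpi_repr x : qpi_fun (repr (x : Quotient.quot (smem S))) = x.
Proof. exact: reprK. Qed.

Lemma qpiZ a x : qpi_fun (a *: x) = qscale a (qpi_fun x).
Proof.
apply/qpi_eqE; rewrite -scalerBr rpredZ //.
by apply/qpi_eqE; rewrite qpi_repr.
Qed.

Lemma qpiD x y : qpi_fun (x + y) = qpi_fun x + qpi_fun y.
Proof. exact: raddfD. Qed.

Lemma qind (P : quotm_type -> Prop) : (forall x, P (qpi_fun x)) -> forall x, P x.
Proof. by move=> h x; rewrite -(qpi_repr x). Qed.

Fact qscaleA a b x : qscale a (qscale b x) = qscale (a * b) x.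
Proof. by elim/qind: x => x; rewrite -!qpiZ scalerA. Qed.
Fact qscale1 : left_id 1 qscale.
Proof. by elim/qind=> x; rewrite -!qpiZ scale1r. Qed.
Fact qscaleDr : right_distributive qscale +%R.
Proof.
move=> a; elim/qind=> x; elim/qind=> y.
by rewrite -qpiD -!qpiZ scalerDr qpiD.
Qed.
Fact qscaleDl x : {morph qscale^~ x : a b / a + b}.
Proof. by elim/qind: x => x a b; rewrite -!qpiZ scalerDl qpiD. Qed.

HB.instance Definition _ :=
  GRing.Zmodule_isLmodule.Build R quotm_type qscaleA qscale1 qscaleDr qscaleDl.

Definition quotm : lmodType R := quotm_type.

Fact qpi_linear : linear (qpi_fun : V -> quotm).
Proof. by move=> a x y; rewrite qpiD qpiZ. Qed.
Definition qpi : {linear V -> quotm} := mk_linear qpi_linear.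

Lemma qpi_surj y : exists x, qpi x = y.
Proof. by elim/qind: y => x; exists x. Qed.

Lemma qpi_eq0 x : (qpi x = 0) <-> (x \in smem S).
Proof.
by have := qpi_eqE x 0; rewrite subr0 -[qpi_fun 0]/(qpi 0) linear0.
Qed.

Section Descent.
Variables (W : lmodType R) (f : {linear V -> W}).
Hypothesis f0 : forall x, x \in smem S -> f x = 0.
Definition qdesc_fun (y : quotm) : W := f (repr (y : Quotient.quot (smem S))).
Lemma qdesc_funE x : qdesc_fun (qpi x) = f x.
Proof.
apply/eqP; rewrite -subr_eq0 -linearB f0 //.
by apply/qpi_eqE; rewrite qpi_repr.
Qed.
Fact qdesc_linear : linear qdesc_fun.
Proof.
move=> a y z; have [x <-] := qpi_surj y; have [x' <-] := qpi_surj z.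
by rewrite -linearP !qdesc_funE linearP.
Qed.
Definition qdesc : {linear quotm -> W} := mk_linear qdesc_linear.
Lemma qdescE x : qdesc (qpi x) = f x. Proof. exact: qdesc_funE. Qed.
End Descent.

End Submodule.

Arguments sincl {R V} S : simpl never.
Arguments corestr : simpl never.
Arguments qpi {R V} S : simpl never.
Arguments qdesc : simpl never.

Section Kernel.
Variables (R : comNzRingType) (U V : lmodType R) (f : {linear U -> V}).

Fact kerm_closed : submod_closed [pred x | f x == 0].
Proof.
split=> [|a x y]; rewrite !inE ?linear0 //.
by move=> /eqP fx /eqP fy; rewrite linearP fx fy scaler0 addr0.
Qed.
Definition kerm : submodule U := Submodule kerm_closed.

Lemma kermP x : (x \in smem kerm) <-> (f x = 0).
Proof. by split=> /eqP. Qed.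

End Kernel.

Section FreeModule.
Variable R : comNzRingType.

Definition freem (T : choiceType) : lmodType R := {freeg T / R}.
Definition fgen (T : choiceType) (t : T) : freem T := << t >>.

Lemma freem_ind (T : choiceType) (P : freem T -> Prop) :
  P 0 -> (forall a t x, P x -> P (a *: fgen t + x)) -> forall x, P x.
Proof.
move=> P0 PS x; rewrite -(freeg_sumE x).
elim: (dom x) => [|t s IHs]; first by rewrite big_nil.
rewrite big_cons.
have -> : << coeff t x *g t >> = coeff t x *: fgen t.
  by apply/eqP/freeg_eqP=> u; rewrite coeffZ !coeffU mul1r.
exact: PS.
Qed.

Section Lift.
Variables (T : choiceType) (M : lmodType R) (f : T -> M).
Fact flift_linear : linear (fglift f : freem T -> M).
Proof.
have f0 : fglift f (0 : freem T) = 0.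
  by have := lift_is_additive f 0 0; rewrite !subrr.
have addf (x y : freem T) : fglift f (x + y) = fglift f x + fglift f y.
  rewrite -[y in LHS]opprK (lift_is_additive f x (- y)) -[- y]sub0r.
  by rewrite (lift_is_additive f 0 y) f0 sub0r opprK.
move=> a x y; rewrite addf; congr (_ + _).
elim/freem_ind: x => [|b t x IHx]; first by rewrite scaler0 f0 scaler0.
have genE c : fglift f (c *: fgen t) = c *: f t.
  rewrite -[RHS]liftU; congr fglift.
  by apply/eqP/freeg_eqP=> u; rewrite coeffZ !coeffU mul1r.
by rewrite scalerDr !addf IHx scalerA !genE scalerDr scalerA.
Qed.
Definition flift : {linear freem T -> M} := mk_linear flift_linear.
Lemma fliftE t : flift (fgen t) = f t.
Proof. by rewrite /flift /= liftU scale1r. Qed.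
End Lift.

Lemma freem_ext (T : choiceType) (M : lmodType R) (f g : {linear freem T -> M}) :
  (forall t, f (fgen t) = g (fgen t)) -> f =1 g.
Proof.
move=> fg; elim/freem_ind=> [|a t x IHx]; first by rewrite !linear0.
by rewrite !linearP fg IHx.
Qed.

Definition free_module (M : lmodType R) : Prop :=
  exists (T : choiceType) (h : {linear freem T -> M}), bijective h.

End FreeModule.

Arguments flift : simpl never.

Section Tensor.
Variable R : comNzRingType.

Section Def.
Variables M N : lmodType R.

Definition tpair (m : M) (n : N) : freem R (M * N)%type := fgen R (m, n).

(* The submodule of R^(M x N) generated by the bilinearity relations. *)
Definition trel (x : freem R (M * N)%type) : Prop :=
  forall S : submodule (freem R (M * N)%type),
    (forall a m m' n,
        tpair (a *: m + m') n - (a *: tpair m n + tpair m' n) \in smem S) ->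
    (forall a m n n',
        tpair m (a *: n + n') - (a *: tpair m n + tpair m n') \in smem S) ->
    x \in smem S.

Fact trel_closed : submod_closed [pred x | `[< trel x >]].
Proof.
split=> [|a x y].
  by apply/asboolP=> S _ _; rewrite rpred0.
move=> /asboolP hx /asboolP hy; apply/asboolP=> S hl hr.
by rewrite rpredD ?rpredZ ?hx ?hy.
Qed.

Definition tens : lmodType R := quotm (Submodule trel_closed).

Definition tpure (m : M) (n : N) : tens := qpi _ (tpair m n).

Lemma tpure_linl a m m' n : tpure (a *: m + m') n = a *: tpure m n + tpure m' n.
Proof.
rewrite /tpure -linearP; apply/eqP; rewrite -subr_eq0 -linearB; apply/eqP.
by apply/qpi_eq0/asboolP=> S hl hr.
Qed.
Lemma tpure_linr a m n n' : tpure m (a *: n + n') = a *: tpure m n + tpure m n'.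
Proof.
rewrite /tpure -linearP; apply/eqP; rewrite -subr_eq0 -linearB; apply/eqP.
by apply/qpi_eq0/asboolP=> S hl hr.
Qed.

Lemma tens_ext (P : lmodType R) (f g : {linear tens -> P}) :
  (forall m n, f (tpure m n) = g (tpure m n)) -> f =1 g.
Proof.
move=> fg y; have [x <-] := qpi_surj y.
have := @freem_ext R _ _ (f \o qpi _) (g \o qpi _) _ x; apply.
by case=> m n; exact: fg.
Qed.

Section Lift.
Variables (P : lmodType R) (b : M -> N -> P).
Hypothesis bl : forall a m m' n, b (a *: m + m') n = a *: b m n + b m' n.
Hypothesis br : forall a m n n', b m (a *: n + n') = a *: b m n + b m n'.
Fact tlift_subproof x : x \in smem (Submodule trel_closed) ->
  flift (fun mn => b mn.1 mn.2) x = 0.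
Proof.
move=> /asboolP /(_ (kerm (flift (fun mn => b mn.1 mn.2)))) h.
apply/kermP; apply: h => *; apply/kermP.
  by rewrite linearB linearP !fliftE /= bl subrr.
by rewrite linearB linearP !fliftE /= br subrr.
Qed.
Definition tlift : {linear tens -> P} := qdesc tlift_subproof.
Lemma tliftE m n : tlift (tpure m n) = b m n.
Proof. by rewrite /tlift /tpure qdescE fliftE. Qed.
End Lift.

End Def.

Section Map.
Variables (M M' N N' : lmodType R).
Variables (f : {linear M -> M'}) (g : {linear N -> N'}).
Fact tmap_linl a m m' n :
  tpure (f (a *: m + m')) (g n) = a *: tpure (f m) (g n) + tpure (f m') (g n).
Proof. by rewrite linearP tpure_linl. Qed.
Fact tmap_linr a m n n' :
  tpure (f m) (g (a *: n + n')) = a *: tpure (f m) (g n) + tpure (f m) (g n').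
Proof. by rewrite linearP tpure_linr. Qed.
Definition tmap : {linear tens M N -> tens M' N'} := tlift tmap_linl tmap_linr.
Lemma tmapE m n : tmap (tpure m n) = tpure (f m) (g n).
Proof. exact: tliftE. Qed.
End Map.

Lemma tmap_comp (M M' M'' N N' N'' : lmodType R)
    (f : {linear M -> M'}) (g : {linear N -> N'})
    (f' : {linear M' -> M''}) (g' : {linear N' -> N''})
    (f2 : {linear M -> M''}) (g2 : {linear N -> N''}) :
  f' \o f =1 f2 -> g' \o g =1 g2 ->
  forall x, tmap f' g' (tmap f g x) = tmap f2 g2 x.
Proof.
move=> hf hg; apply: (@tens_ext M N _ (tmap f' g' \o tmap f g)) => m n.
by rewrite -[LHS]/(tmap f' g' (tmap f g (tpure m n))) !tmapE -hf -hg.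
Qed.

Lemma tpure0l (M N : lmodType R) (n : N) : tpure (0 : M) n = 0.
Proof.
by have := tpure_linl (-1) (0 : M) 0 n; rewrite scaler0 addr0 scaleN1r addNr.
Qed.
Lemma tpure0r (M N : lmodType R) (m : M) : tpure m (0 : N) = 0.
Proof.
by have := tpure_linr (-1) m (0 : N) 0; rewrite scaler0 addr0 scaleN1r addNr.
Qed.
Lemma tpureZl (M N : lmodType R) a (m : M) (n : N) :
  tpure (a *: m) n = a *: tpure m n.
Proof. by have := tpure_linl a m 0 n; rewrite !addr0 tpure0l addr0. Qed.
Lemma tpureZr (M N : lmodType R) a (m : M) (n : N) :
  tpure m (a *: n) = a *: tpure m n.
Proof. by have := tpure_linr a m n 0; rewrite !addr0 tpure0r addr0. Qed.

Lemma tmap_eq0 (M M' N N' : lmodType R)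
    (f : {linear M -> M'}) (g : {linear N -> N'}) :
  f =1 (fun=> 0) \/ g =1 (fun=> 0) -> tmap f g =1 (fun=> 0).
Proof.
move=> fg; apply: (@tens_ext M N _ (tmap f g) \0) => m n.
by rewrite tmapE; case: fg => ->; rewrite ?tpure0l ?tpure0r.
Qed.

End Tensor.

Arguments tlift : simpl never.
Arguments tmap : simpl never.

Section Torsion.
Variable R : comNzRingType.

(* For K = S inside F: the kernel of K (x) N -> F (x) N. If F and K are free,
   this is the torsion product (F/K) * N computed from 0 -> K -> F -> F/K. *)
Definition tor_res (F : lmodType R) (S : submodule F) (N : lmodType R) :
  lmodType R := subm (kerm (tmap (sincl S) (lin_id N))).

Section ResMap.
Variables (F F' : lmodType R) (S : submodule F) (S' : submodule F').
Variables (phi : {linear F -> F'}).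
Hypothesis phiS : forall x, x \in smem S -> phi x \in smem S'.
Fact restr_subproof (x : subm S) : (phi \o sincl S) x \in smem S'.
Proof. exact/phiS/sincl_in. Qed.
Definition restr : {linear subm S -> subm S'} := corestr restr_subproof.

Variables (N N' : lmodType R) (g : {linear N -> N'}).
Fact tor_res_map_subproof (t : tor_res S N) :
  (tmap restr g \o sincl _) t \in smem (kerm (tmap (sincl S') (lin_id N'))).
Proof.
apply/kermP; rewrite -[LHS]/(tmap _ _ (tmap restr g (sincl _ t))).
rewrite (@tmap_comp _ _ _ _ _ _ _ _ _ _ _ (phi \o sincl S) g) //.
rewrite -(@tmap_comp _ _ _ _ _ _ _ (sincl S) (lin_id N) phi g) //.
have /kermP -> := sincl_in t; exact: linear0.
Qed.
Definition tor_res_map : {linear tor_res S N -> tor_res S' N'} :=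
  corestr tor_res_map_subproof.
End ResMap.

(* The standard free resolution 0 -> K(M) -> R^(M) -> M -> 0; K(M) is free when
   R is a principal ideal domain. *)
Definition std_aug (M : lmodType R) : {linear freem R M -> M} := flift id.
Definition std_rel (M : lmodType R) : submodule (freem R M) := kerm (std_aug M).

Definition tor (M N : lmodType R) : lmodType R := tor_res (std_rel M) N.

Section Functoriality.
Variables (M M' N N' : lmodType R).
Variables (f : {linear M -> M'}) (g : {linear N -> N'}).
Definition std_map : {linear freem R M -> freem R M'} :=
  flift (fun m => fgen R (f m)).
Fact std_aug_map x : std_aug M' (std_map x) = f (std_aug M x).
Proof.
move: x; apply: (@freem_ext R M _ (std_aug M' \o std_map) (f \o std_aug M)) => m.
rewrite -[LHS]/(std_aug M' (std_map (fgen R m))).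
by rewrite -[RHS]/(f (std_aug M (fgen R m))) !fliftE.
Qed.
Fact std_map_rel x : x \in smem (std_rel M) -> std_map x \in smem (std_rel M').
Proof. by move=> /kermP x0; apply/kermP; rewrite std_aug_map x0 linear0. Qed.
Definition tor_map : {linear tor M N -> tor M' N'} := tor_res_map (@std_map_rel) g.
End Functoriality.

(* The elementary tor <a, r, b>, for the lift [a] in R^(M) of a. *)
Section ElementaryTor.
Variables (M N : lmodType R) (a : M) (r : R) (b : N).
Hypotheses (ra : r *: a = 0) (rb : r *: b = 0).
Fact etor_rel : r *: fgen R a \in smem (std_rel M).
Proof. by apply/kermP; rewrite linearZ fliftE. Qed.
Definition etor_val : tens (subm (std_rel M)) N :=
  tpure (exist _ (r *: fgen R a) etor_rel : subm (std_rel M)) b.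
Fact etor_subproof :
  etor_val \in smem (kerm (tmap (sincl (std_rel M)) (lin_id N))).
Proof.
apply/kermP; rewrite tmapE -[sincl _ _]/(r *: fgen R a) tpureZl -tpureZr.
by rewrite -[lin_id N b]/b rb tpure0r.
Qed.
Definition etor : tor M N := exist _ etor_val etor_subproof.
End ElementaryTor.

Lemma tor_ext (M N : lmodType R) (s t : tor M N) : sincl _ s = sincl _ t -> s = t.
Proof. exact: sincl_inj. Qed.

Lemma tor_mapE (M M' N N' : lmodType R) (f : {linear M -> M'})
    (g : {linear N -> N'}) (t : tor M N) :
  sincl _ (tor_map f g t) = tmap (restr (@std_map_rel _ _ f)) g (sincl _ t).
Proof. by []. Qed.

Lemma restr_std_comp (M M' M'' : lmodType R)
    (f : {linear M -> M'}) (f' : {linear M' -> M''}) (f2 : {linear M -> M''}) :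
  f' \o f =1 f2 ->
  restr (@std_map_rel _ _ f') \o restr (@std_map_rel _ _ f)
    =1 restr (@std_map_rel _ _ f2).
Proof.
move=> hf x; apply: sincl_inj.
rewrite -[LHS]/(std_map f' (std_map f (sincl _ x))).
rewrite -[RHS]/(std_map f2 (sincl _ x)); move: (sincl _ x).
apply: (@freem_ext R M _ (std_map f' \o std_map f)) => m.
rewrite -[LHS]/(std_map f' (std_map f (fgen R m))).
by rewrite !fliftE -hf.
Qed.

Lemma tor_map_comp (M M' M'' N N' N'' : lmodType R)
    (f : {linear M -> M'}) (g : {linear N -> N'})
    (f' : {linear M' -> M''}) (g' : {linear N' -> N''})
    (f2 : {linear M -> M''}) (g2 : {linear N -> N''}) :
  f' \o f =1 f2 -> g' \o g =1 g2 ->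
  forall x, tor_map f' g' (tor_map f g x) = tor_map f2 g2 x.
Proof.
move=> hf hg x; apply: tor_ext; rewrite !tor_mapE.
by apply: tmap_comp => //; exact: restr_std_comp.
Qed.

Lemma tor_map_eq0r (M M' N N' : lmodType R)
    (f : {linear M -> M'}) (g : {linear N -> N'}) :
  g =1 (fun=> 0) -> tor_map f g =1 (fun=> 0).
Proof.
move=> g0 x; apply: tor_ext; rewrite tor_mapE linear0.
by apply: tmap_eq0; right.
Qed.

Lemma tor_map_eq0l (M M' N N' : lmodType R)
    (f : {linear M -> M'}) (g : {linear N -> N'}) :
  f =1 (fun=> 0) -> tor_map f g =1 (fun=> 0).
Proof.
move=> f0 x; apply: tor_ext; rewrite tor_mapE linear0.
have hF y : std_map f y \in smem (std_rel M').
  by apply/kermP; rewrite std_aug_map f0.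
have := sincl_in x => /kermP x0.
rewrite -(@tmap_comp _ _ _ _ _ _ _ (sincl _) (lin_id N) (corestr hF) g) //.
  by rewrite x0 linear0.
by move=> y; apply: sincl_inj.
Qed.

End Torsion.

Section Complexes.
Variable R : comNzRingType.

(* The differential is the family of its components C_n -> C_m, which vanish
   unless n = m + 1. *)
Record complex := Complex {
  cobj :> int -> lmodType R;
  cdiff : forall n m, {linear cobj n -> cobj m};
  cdiff_shape : forall n m, n != m + 1 -> cdiff n m =1 (fun=> 0);
  cdiffK : forall n m k x, cdiff m k (cdiff n m x) = 0
}.

Record chain_map (C D : complex) := ChainMap {
  cmap :> forall n, {linear C n -> D n};
  cmapP : forall n m x, cmap m (cdiff C n m x) = cdiff D n m (cmap n x)
}.

Definition cyc (C : complex) n : submodule (C n) := kerm (cdiff C n (n - 1)).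
Definition cycles (C : complex) n : lmodType R := subm (cyc C n).

Lemma cycleP (C : complex) n (z : cycles C n) m : cdiff C n m (sincl _ z) = 0.
Proof.
case: (eqVneq n (m + 1)) => [e|ne]; last by rewrite cdiff_shape.
have <- : n - 1 = m by rewrite e addrK.
by have /kermP := sincl_in z.
Qed.

Section Boundaries.
Variables (C : complex) (n : int).
Fact bnd_closed : submod_closed
  [pred z : cycles C n | `[< exists y, cdiff C (n + 1) n y = sincl _ z >]].
Proof.
split=> [|a x y].
  by apply/asboolP; exists 0; rewrite !linear0.
move=> /asboolP[u hu] /asboolP[v hv]; apply/asboolP; exists (a *: u + v).
by rewrite !linearP hu hv.
Qed.
Definition bnd : submodule (cycles C n) := Submodule bnd_closed.
Definition boundaries : lmodType R := subm bnd.
Definition homology : lmodType R := quotm bnd.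
Definition hclass : {linear cycles C n -> homology} := qpi bnd.

Fact bdiff_subproof1 (x : C (n + 1)) : cdiff C (n + 1) n x \in smem (cyc C n).
Proof. by apply/kermP; rewrite cdiffK. Qed.
Fact bdiff_subproof2 (x : C (n + 1)) : corestr bdiff_subproof1 x \in smem bnd.
Proof. by apply/asboolP; exists x. Qed.
Definition bdiff : {linear C (n + 1) -> boundaries} := corestr bdiff_subproof2.
End Boundaries.

Definition acyclic (C : complex) : Prop :=
  forall n (x : homology C n), x = 0.

Section HomologyMap.
Variables (C D : complex) (f : chain_map C D) (n : int).
Fact cyc_map_subproof x : x \in smem (cyc C n) -> f n x \in smem (cyc D n).
Proof. by move=> /kermP x0; apply/kermP; rewrite -cmapP x0 linear0. Qed.
Definition cyc_map : {linear cycles C n -> cycles D n} := restr cyc_map_subproof.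
Fact hmap_subproof z :
  z \in smem (bnd C n) -> (hclass D n \o cyc_map) z = 0.
Proof.
move=> /asboolP[y hy]; apply/qpi_eq0/asboolP; exists (f (n + 1) y).
by rewrite -cmapP hy.
Qed.
Definition hmap : {linear homology C n -> homology D n} := qdesc hmap_subproof.
End HomologyMap.

Definition quasi_iso (C D : complex) (f : chain_map C D) : Prop :=
  forall n, bijective (hmap f n).

Definition free_complex (C : complex) : Prop := forall n, free_module (C n).

End Complexes.

Section Product.
Variables (R : comNzRingType) (I : Type) (M : I -> lmodType R).
Definition dprod_type : Type := forall i, M i.
HB.instance Definition _ := gen_eqMixin dprod_type.
HB.instance Definition _ := gen_choiceMixin dprod_type.

Local Notation T := dprod_type.
Definition dprod_add (x y : T) : T := fun i => x i + y i.
Definition dprod_opp (x : T) : T := fun i => - x i.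
Definition dprod_zero : T := fun i => 0.
Definition dprod_scale (a : R) (x : T) : T := fun i => a *: x i.
Fact dprod_addA : associative dprod_add.
Proof. by move=> x y z; apply: functional_extensionality_dep => i; exact: addrA. Qed.
Fact dprod_addC : commutative dprod_add.
Proof. by move=> x y; apply: functional_extensionality_dep => i; exact: addrC. Qed.
Fact dprod_add0 : left_id dprod_zero dprod_add.
Proof. by move=> x; apply: functional_extensionality_dep => i; exact: add0r. Qed.
Fact dprod_addN : left_inverse dprod_zero dprod_opp dprod_add.
Proof. by move=> x; apply: functional_extensionality_dep => i; exact: addNr. Qed.
HB.instance Definition _ :=
  GRing.isZmodule.Build T dprod_addA dprod_addC dprod_add0 dprod_addN.
Fact dprod_scaleA a b x : dprod_scale a (dprod_scale b x) = dprod_scale (a * b) x.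
Proof. by apply: functional_extensionality_dep => i; exact: scalerA. Qed.
Fact dprod_scale1 : left_id 1 dprod_scale.
Proof. by move=> x; apply: functional_extensionality_dep => i; exact: scale1r. Qed.
Fact dprod_scaleDr : right_distributive dprod_scale +%R.
Proof. by move=> a x y; apply: functional_extensionality_dep => i; exact: scalerDr. Qed.
Fact dprod_scaleDl x : {morph dprod_scale^~ x : a b / a + b}.
Proof. by move=> a b; apply: functional_extensionality_dep => i; exact: scalerDl. Qed.
HB.instance Definition _ :=
  GRing.Zmodule_isLmodule.Build R T dprod_scaleA dprod_scale1
    dprod_scaleDr dprod_scaleDl.
Definition dprod : lmodType R := T.
End Product.

Section Total.
Variable R : comNzRingType.

(* (-1)^p, for any integer p. *)
Definition sgn (p : int) : R := (-1) ^+ `|p|%N.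

(* The differentials commute; the sign is introduced in the total complex. *)
Record bicomplex := Bicomplex {
  bobj :> int -> int -> lmodType R;
  bhor : forall p p' q, {linear bobj p q -> bobj p' q};
  bver : forall p q q', {linear bobj p q -> bobj p q'};
  bhorK : forall p p' p'' q x, bhor p' p'' q (bhor p p' q x) = 0;
  bverK : forall p q q' q'' x, bver p q' q'' (bver p q q' x) = 0;
  bhorver : forall p p' q q' x,
    bhor p p' q' (bver p q q' x) = bver p' q q' (bhor p p' q x)
}.

Section Def.
Variable D : bicomplex.

Definition bfam : lmodType R := dprod (fun pq : int * int => D pq.1 pq.2).

(* Degree n of the total complex: the direct sum of the D p q with p + q = n. *)
Fact tot_closed (n : int) : submod_closed
  [pred x : bfam | `[< (forall pq, pq.1 + pq.2 != n -> x pq = 0) /\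
     exists s : seq (int * int), forall pq, pq \notin s -> x pq = 0 >]].
Proof.
split=> [|a x y]; first by apply/asboolP; split=> //; exists [::].
move=> /asboolP[x0 [s xs]] /asboolP[y0 [t yt]]; apply/asboolP; split.
  move=> pq h; rewrite -[LHS]/(a *: x pq + y pq).
  by rewrite x0 // y0 // scaler0 addr0.
exists (s ++ t) => pq; rewrite mem_cat negb_or => /andP[hs ht].
by rewrite -[LHS]/(a *: x pq + y pq) xs // yt // scaler0 addr0.
Qed.
Definition totm (n : int) : submodule bfam := Submodule (tot_closed n).

Definition tot_dfun (x : bfam) : bfam := fun pq =>
  bhor D (pq.1 + 1) pq.1 pq.2 (x (pq.1 + 1, pq.2)) +
  sgn pq.1 *: bver D pq.1 (pq.2 + 1) pq.2 (x (pq.1, pq.2 + 1)).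

Lemma tot_dfunE x p q : tot_dfun x (p, q) =
  bhor D (p + 1) p q (x (p + 1, q)) + sgn p *: bver D p (q + 1) q (x (p, q + 1)).
Proof. by []. Qed.

Fact tot_dfun_linear : linear tot_dfun.
Proof.
move=> a x y; apply: functional_extensionality_dep => -[p q].
rewrite -[RHS]/(a *: tot_dfun x (p, q) + tot_dfun y (p, q)).
rewrite !tot_dfunE -[(a *: x + y) (p + 1, q)]/(a *: x (p + 1, q) + y (p + 1, q)).
rewrite -[(a *: x + y) (p, q + 1)]/(a *: x (p, q + 1) + y (p, q + 1)).
by rewrite !linearP !scalerDr addrACA !scalerA.
Qed.

Definition tot_dcomp (n m : int) (x : subm (totm n)) : bfam :=
  if n == m + 1 then tot_dfun (sincl _ x) else 0.

Fact tot_dcomp_linear n m : linear (@tot_dcomp n m).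
Proof.
move=> a x y; rewrite /tot_dcomp; case: eqP => _; last by rewrite scaler0 addr0.
by rewrite linearP tot_dfun_linear.
Qed.

Fact tot_dcomp_in n m x : mk_linear (@tot_dcomp_linear n m) x \in smem (totm m).
Proof.
rewrite -[mk_linear _ _]/(tot_dcomp m x) /tot_dcomp.
case: eqP => [nm|_]; last by rewrite rpred0.
have /asboolP[x0 [s xs]] := sincl_in x.
apply/asboolP; split=> [[p q] pq|]; last first.
  exists ([seq (i.1 - 1, i.2) | i <- s] ++ [seq (i.1, i.2 - 1) | i <- s]).
  case=> p q; rewrite mem_cat negb_or => /andP[h1 h2].
  rewrite tot_dfunE !xs ?linear0 ?scaler0 ?addr0 //.
    apply: contra h2 => h; apply/mapP; exists (p, q + 1) => //=.
    by rewrite addrK.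
  apply: contra h1 => h; apply/mapP; exists (p + 1, q) => //=.
  by rewrite addrK.
by rewrite tot_dfunE !x0 ?linear0 ?scaler0 ?addr0 //; move: pq => /=; lia.
Qed.

Definition tot_diff n m : {linear subm (totm n) -> subm (totm m)} :=
  corestr (@tot_dcomp_in n m).

Fact tot_diff_shape n m : n != m + 1 -> tot_diff n m =1 (fun=> 0).
Proof.
move=> /negbTE nm x; apply: sincl_inj; rewrite linear0.
by rewrite -[LHS]/(tot_dcomp m x) /tot_dcomp nm.
Qed.

Lemma sgnS p : sgn (p + 1) = - sgn p.
Proof.
have signE k l : odd k = ~~ odd l -> (-1) ^+ k = - (-1) ^+ l :> R.
  move=> e; rewrite -(signr_odd R k) -(signr_odd R l) e.
  by case: (odd l); rewrite ?expr0 ?expr1 ?opprK.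
by apply: signE; lia.
Qed.

Fact tot_diffK n m k x : tot_diff m k (tot_diff n m x) = 0.
Proof.
apply: sincl_inj; rewrite linear0 -[LHS]/(tot_dcomp k (tot_diff n m x)).
rewrite /tot_dcomp; case: eqP => // _.
rewrite -[sincl _ _]/(tot_dcomp m x) /tot_dcomp.
case: eqP => [_|_]; apply: functional_extensionality_dep => -[p q].
  rewrite !tot_dfunE !linearD !linearZ /= bhorK bverK bhorver sgnS.
  by rewrite add0r !scaler0 addr0 scaleNr addNr.
by rewrite tot_dfunE -[(0 : bfam) _]/0 -[(0 : bfam) (p, _)]/0 !linear0 addr0.
Qed.

Definition total : complex R := Complex tot_diff_shape tot_diffK.

Section Inject.
Variables (n i j : int).

(* The inclusion of D i j as a summand of total degree n; it is only meaningful
   for i + j = n. *)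
Definition tot_in_fun (x : D i j) : bfam :=
  if i + j == n then
    (dfwith (fun pq : int * int => (0 : D pq.1 pq.2))
       (x : D (i, j).1 (i, j).2) : bfam)
  else 0.

Fact tot_in_linear : linear tot_in_fun.
Proof.
move=> a x y; rewrite /tot_in_fun; case: eqP => _; last by rewrite scaler0 addr0.
apply: functional_extensionality_dep => pq.
rewrite -[RHS]/(a *: dfwith _ _ pq + dfwith _ _ pq).
case: (eqVneq (i, j) pq) => [e|e]; first by case: pq / e; rewrite !dfwith_in.
by rewrite !dfwith_out // scaler0 addr0.
Qed.

Fact tot_in_in x : mk_linear tot_in_linear x \in smem (totm n).
Proof.
rewrite -[mk_linear _ _]/(tot_in_fun x) /tot_in_fun.
case: eqP => [ij|_]; last by rewrite rpred0.
apply/asboolP; split=> [pq h|].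
  by rewrite dfwith_out //; apply: contra h => /eqP <-; apply/eqP.
by exists [:: (i, j)] => pq; rewrite inE eq_sym => h; rewrite dfwith_out.
Qed.
Definition tot_in : {linear D i j -> total n} := corestr tot_in_in.
End Inject.

Lemma tot_in_same n i j (x : D i j) :
  i + j = n -> sincl _ (tot_in n _ _ x) (i, j) = x.
Proof.
move=> /eqP ij; rewrite -[sincl _ _]/(tot_in_fun n x) /tot_in_fun ij.
exact: dfwith_in.
Qed.

Lemma tot_in_diff n i j (x : D i j) pq :
  (i, j) != pq -> sincl _ (tot_in n _ _ x) pq = 0.
Proof.
move=> h; rewrite -[sincl _ _]/(tot_in_fun n x) /tot_in_fun.
by case: eqP => // _; rewrite dfwith_out.
Qed.

Lemma total_diffE n (x : total n) p q : sincl _ (cdiff total n (n - 1) x) (p, q) =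
  bhor D (p + 1) p q (sincl _ x (p + 1, q)) +
  sgn p *: bver D p (q + 1) q (sincl _ x (p, q + 1)).
Proof.
rewrite -[LHS]/(tot_dcomp (n - 1) x (p, q)) /tot_dcomp subrK eqxx.
exact: tot_dfunE.
Qed.

Lemma total_diff_inl n i j (x : D (i + 1) j) : i + j + 1 = n ->
  (forall q, bver D (i + 1) j q x = 0) ->
  cdiff total n (n - 1) (tot_in n _ _ x) = tot_in (n - 1) i j (bhor D (i + 1) i j x).
Proof.
move=> hn x0; apply: sincl_inj; apply: functional_extensionality_dep => -[p q].
rewrite total_diffE.
have -> : bver D p (q + 1) q (sincl _ (tot_in n _ _ x) (p, q + 1)) = 0.
  case: (eqVneq (i + 1, j) (p, q + 1)) => [[e1 e2]|ne].
    by subst p j; rewrite tot_in_same ?x0 //; lia.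
  by rewrite tot_in_diff // linear0.
rewrite scaler0 addr0; case: (eqVneq (i, j) (p, q)) => [[e1 e2]|ne].
  by subst p q; rewrite !tot_in_same //; lia.
rewrite !tot_in_diff ?linear0 //.
by apply: contra ne => /eqP[/addIr -> ->].
Qed.

Lemma total_diff_inr n i j (x : D i (j + 1)) : i + j + 1 = n ->
  (forall p, bhor D i p (j + 1) x = 0) ->
  cdiff total n (n - 1) (tot_in n _ _ x) =
    sgn i *: tot_in (n - 1) i j (bver D i (j + 1) j x).
Proof.
move=> hn x0; apply: sincl_inj; apply: functional_extensionality_dep => -[p q].
rewrite total_diffE linearZ -[RHS]/(sgn i *: sincl (totm (n - 1)) _ (p, q)).
have -> : bhor D (p + 1) p q (sincl _ (tot_in n _ _ x) (p + 1, q)) = 0.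
  case: (eqVneq (i, j + 1) (p + 1, q)) => [[e1 e2]|ne].
    by subst i q; rewrite tot_in_same ?x0 //; lia.
  by rewrite tot_in_diff // linear0.
rewrite add0r; case: (eqVneq (i, j) (p, q)) => [[e1 e2]|ne].
  by subst p q; rewrite !tot_in_same //; lia.
rewrite !tot_in_diff ?linear0 ?scaler0 //.
by apply: contra ne => /eqP[-> /addIr ->].
Qed.

Definition tot_comp n p q (x : total n) : D p q := (sincl (totm n) x) (p, q).

End Def.

Section Map.
Variables (D E : bicomplex) (f : forall p q, {linear D p q -> E p q}).
Hypothesis fhor : forall p p' q x,
  f p' q (bhor D p p' q x) = bhor E p p' q (f p q x).
Hypothesis fver : forall p q q' x,
  f p q' (bver D p q q' x) = bver E p q q' (f p q x).

Definition tot_map_fun (x : bfam D) : bfam E := fun pq => f pq.1 pq.2 (x pq).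
Fact tot_map_linear : linear tot_map_fun.
Proof.
by move=> a x y; apply: functional_extensionality_dep => pq; exact: linearP.
Qed.
Fact tot_map_in n x :
  x \in smem (totm D n) -> mk_linear tot_map_linear x \in smem (totm E n).
Proof.
move=> /asboolP[x0 [s xs]]; apply/asboolP; split=> [pq h|].
  by rewrite -[LHS]/(f _ _ (x pq)) x0 ?linear0.
by exists s => pq h; rewrite -[LHS]/(f _ _ (x pq)) xs ?linear0.
Qed.
Definition tot_map_deg n : {linear total D n -> total E n} :=
  restr (@tot_map_in n).
Fact tot_mapP n m x :
  tot_map_deg m (cdiff (total D) n m x) = cdiff (total E) n m (tot_map_deg n x).
Proof.
apply: sincl_inj.
rewrite -[LHS]/(tot_map_fun (tot_dcomp m x)).
rewrite -[RHS]/(tot_dcomp m (tot_map_deg n x)) /tot_dcomp.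
case: eqP => _; apply: functional_extensionality_dep => -[p q].
  rewrite -[LHS]/(f p q (tot_dfun _ (p, q))) !tot_dfunE linearD linearZ.
  by rewrite fhor fver.
exact: linear0.
Qed.
Definition tot_map : chain_map (total D) (total E) := 
  @ChainMap R (total D) (total E) tot_map_deg tot_mapP.
End Map.

End Total.

Section Products.
Variable R : comNzRingType.

Section Tensor.
Variables A B : complex R.
Fact tensor_horK p p' p'' q (x : tens (A p) (B q)) :
  tmap (cdiff A p' p'') (lin_id (B q))
    (tmap (cdiff A p p') (lin_id (B q)) x) = 0.
Proof.
rewrite (@tmap_comp _ _ _ _ _ _ _ _ _ _ _ \0 (lin_id (B q))) //.
  by apply: tmap_eq0; left.
by move=> y; exact: cdiffK.
Qed.
Fact tensor_verK p q q' q'' (x : tens (A p) (B q)) :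
  tmap (lin_id (A p)) (cdiff B q' q'')
    (tmap (lin_id (A p)) (cdiff B q q') x) = 0.
Proof.
rewrite (@tmap_comp _ _ _ _ _ _ _ _ _ _ _ (lin_id (A p)) \0) //.
  by apply: tmap_eq0; right.
by move=> y; exact: cdiffK.
Qed.
Fact tensor_horver p p' q q' (x : tens (A p) (B q)) :
  tmap (cdiff A p p') (lin_id (B q')) (tmap (lin_id (A p)) (cdiff B q q') x) =
  tmap (lin_id (A p')) (cdiff B q q') (tmap (cdiff A p p') (lin_id (B q)) x).
Proof.
rewrite (@tmap_comp _ _ _ _ _ _ _ _ _ _ _ (cdiff A p p') (cdiff B q q')) //.
by rewrite (@tmap_comp _ _ _ _ _ _ _ _ _ _ _ (cdiff A p p') (cdiff B q q')).
Qed.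
Definition tensor_bicomplex : bicomplex R :=
  Bicomplex tensor_horK tensor_verK tensor_horver.
Definition tensor : complex R := total tensor_bicomplex.
End Tensor.

Section Torsion.
Variables A B : complex R.
Fact torsion_horK p p' p'' q (x : tor (A p) (B q)) :
  tor_map (cdiff A p' p'') (lin_id (B q))
    (tor_map (cdiff A p p') (lin_id (B q)) x) = 0.
Proof.
rewrite (@tor_map_comp _ _ _ _ _ _ _ _ _ _ _ \0 (lin_id (B q))) //.
  exact: tor_map_eq0l.
by move=> y; exact: cdiffK.
Qed.
Fact torsion_verK p q q' q'' (x : tor (A p) (B q)) :
  tor_map (lin_id (A p)) (cdiff B q' q'')
    (tor_map (lin_id (A p)) (cdiff B q q') x) = 0.
Proof.
rewrite (@tor_map_comp _ _ _ _ _ _ _ _ _ _ _ (lin_id (A p)) \0) //.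
  exact: tor_map_eq0r.
by move=> y; exact: cdiffK.
Qed.
Fact torsion_horver p p' q q' (x : tor (A p) (B q)) :
  tor_map (cdiff A p p') (lin_id (B q'))
    (tor_map (lin_id (A p)) (cdiff B q q') x) =
  tor_map (lin_id (A p')) (cdiff B q q')
    (tor_map (cdiff A p p') (lin_id (B q)) x).
Proof.
rewrite (@tor_map_comp _ _ _ _ _ _ _ _ _ _ _ (cdiff A p p') (cdiff B q q')) //.
by rewrite (@tor_map_comp _ _ _ _ _ _ _ _ _ _ _ (cdiff A p p') (cdiff B q q')).
Qed.
Definition torsion_bicomplex : bicomplex R :=
  Bicomplex torsion_horK torsion_verK torsion_horver.
Definition torsion : complex R := total torsion_bicomplex.
End Torsion.

Section TensorMap.
Variables (A A' B B' : complex R) (f : chain_map A A') (g : chain_map B B').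
Definition tensor_map_comp p q :
  {linear tensor_bicomplex A B p q -> tensor_bicomplex A' B' p q} :=
  tmap (f p) (g q).
Fact tensor_map_hor p p' q x :
  tensor_map_comp p' q (bhor (tensor_bicomplex A B) p p' q x) =
  bhor (tensor_bicomplex A' B') p p' q (tensor_map_comp p q x).
Proof.
rewrite [LHS](@tmap_comp _ _ _ _ _ _ _ _ _ _ _ (f p' \o cdiff A p p') (g q)) //.
rewrite [RHS](@tmap_comp _ _ _ _ _ _ _ _ _ _ _ (f p' \o cdiff A p p') (g q)) //.
by move=> y; rewrite /= cmapP.
Qed.
Fact tensor_map_ver p q q' x :
  tensor_map_comp p q' (bver (tensor_bicomplex A B) p q q' x) =
  bver (tensor_bicomplex A' B') p q q' (tensor_map_comp p q x).
Proof.
rewrite [LHS](@tmap_comp _ _ _ _ _ _ _ _ _ _ _ (f p) (g q' \o cdiff B q q')) //.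
rewrite [RHS](@tmap_comp _ _ _ _ _ _ _ _ _ _ _ (f p) (g q' \o cdiff B q q')) //.
by move=> y; rewrite /= cmapP.
Qed.
Definition tensor_map : chain_map (tensor A B) (tensor A' B') :=
  tot_map tensor_map_hor tensor_map_ver.
End TensorMap.

End Products.

Section Kuenneth.
Variable R : comNzRingType.

(* The map beta_{k,l} : H_n(F (x) G) -> H_k(F) * H_l(G) of the Kuenneth formula,
   n = k + l + 1, for free complexes: a cycle c is sent to the class of (d (x) 1) c. The
   component c_{k+1,l} is sent by d (x) 1 into B_k (x) Z_l, and thence to
   ker (B_k (x) H_l -> Z_k (x) H_l), the torsion product H_k * H_l computed from
   the free resolution 0 -> B_k -> Z_k -> H_k. *)
Definition kuenneth_free_rel (F G : complex R) (n k l : int)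
    (c : cycles (tensor F G) n) (u : tor_res (bnd F k) (homology G l)) : Prop :=
  exists w : tens (boundaries F k) (cycles G l),
    tmap (lin_id (boundaries F k)) (sincl (cyc G l)) w =
      tmap (bdiff F k) (lin_id (G l)) (tot_comp (k + 1) l (sincl _ c)) /\
    sincl _ u = tmap (lin_id (boundaries F k)) (hclass G l) w.

(* In general beta is transported along quasi-isomorphisms f : F -> A and
   g : G -> B with F and G free. The map H_k(F) * H_l(G) -> H_k(A) * H_l(B)
   induced by H(f) and H(g) is computed from any lift phi of H(f) to the free
   resolutions 0 -> B_k(F) -> Z_k(F) -> H_k(F) and
   0 -> K(H_k(A)) -> R^(H_k(A)) -> H_k(A). *)
Definition kuenneth_rel (A B : complex R) (n k l : int)
    (x : homology (tensor A B) n) (t : tor (homology A k) (homology B l)) : Prop :=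
  exists (F G : complex R) (f : chain_map F A) (g : chain_map G B),
  [/\ free_complex F, free_complex G, quasi_iso f & quasi_iso g] /\
  exists (c : cycles (tensor F G) n) (u : tor_res (bnd F k) (homology G l))
    (phi : {linear cycles F k -> freem R (homology A k)})
    (phiS : forall z, z \in smem (bnd F k) ->
      phi z \in smem (std_rel (homology A k))),
  [/\ hmap (tensor_map f g) n (hclass _ n c) = x,
      kuenneth_free_rel c u,
      forall z, std_aug _ (phi z) = hmap f k (hclass F k z) &
      t = tor_res_map phiS (hmap g l) u].

(* beta_{k,l} x = t: the value obtained by transport along quasi-isomorphisms
   exists, is independent of all the choices made, and equals t. *)
Definition kuenneth_beta_eq (A B : complex R) (n k l : int)
    (x : homology (tensor A B) n) (t : tor (homology A k) (homology B l)) : Prop :=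
  kuenneth_rel x t /\ forall u, kuenneth_rel x u -> u = t.

Definition splits_kuenneth (A B : complex R) (i j : int)
    (sigma : tor (homology A i) (homology B j) ->
             homology (tensor A B) (i + j + 1)) : Prop :=
  (forall t, kuenneth_beta_eq (sigma t) t) /\
  (forall k l, k + l = i + j -> (k, l) != (i, j) ->
     forall t, kuenneth_beta_eq (sigma t)
                 (0 : tor (homology A k) (homology B l))).

End Kuenneth.

Section WeakSplitting.
Variable R : comNzRingType.

(* The submodule of relations of degree n is the kernel of ws_aug n. *)
Record weak_splitting (A : complex R) := WeakSplitting {
  wsZ : int -> lmodType R;
  ws_aug : forall n, {linear wsZ n -> homology A n};
  ws_aug_surj : forall n h, exists z, ws_aug n z = h;
  wsZ_free : forall n, free_module (wsZ n);
  wsB_free : forall n, free_module (subm (kerm (ws_aug n)));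
  ws_gamma : forall n, {linear wsZ n -> cycles A n};
  ws_theta : forall n, {linear subm (kerm (ws_aug n)) -> A (n + 1)};
  ws_gammaP : forall n z, hclass A n (ws_gamma n z) = ws_aug n z;
  ws_thetaP : forall n w,
    cdiff A (n + 1) n (ws_theta n w) = sincl _ (ws_gamma n (sincl _ w))
}.

Definition wsB (A : complex R) (gA : weak_splitting A) (n : int) : lmodType R :=
  subm (kerm (ws_aug gA n)).

Section ScaledLift.
Variables (A : complex R) (gA : weak_splitting A) (n : int).
Variables (r : R) (a : homology A n) (ah : wsZ gA n).
Hypotheses (ra : r *: a = 0) (ahP : ws_aug gA n ah = a).
Fact scaled_lift_subproof : r *: ah \in smem (kerm (ws_aug gA n)).
Proof. by apply/kermP; rewrite linearZ ahP. Qed.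
Definition scaled_lift : wsB gA n := exist _ (r *: ah) scaled_lift_subproof.
End ScaledLift.

Section MCycle.
Variables (A B : complex R) (gA : weak_splitting A) (gB : weak_splitting B).
Variables (i j : int) (a : homology A i) (r : R) (b : homology B j).
Hypotheses (ra : r *: a = 0) (rb : r *: b = 0).
Variables (ah : wsZ gA i) (bh : wsZ gB j).
Hypotheses (ahP : ws_aug gA i ah = a) (bhP : ws_aug gB j bh = b).

(* The sum M(ah, r, bh); the sign is (-1)^(i+1). *)
Definition M_chain : tensor A B (i + j + 1) :=
  sgn R (i + 1) *:
    tot_in (tensor_bicomplex A B) (i + j + 1) i (j + 1)
      (tpure (sincl _ (ws_gamma gA i ah)) (ws_theta gB j (scaled_lift rb bhP)))
  + tot_in (tensor_bicomplex A B) (i + j + 1) (i + 1) j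
      (tpure (ws_theta gA i (scaled_lift ra ahP)) (sincl _ (ws_gamma gB j bh))).

Fact M_chain_cycle : M_chain \in smem (cyc (tensor A B) (i + j + 1)).
Proof.
apply/kermP; rewrite /M_chain linearD linearZ.
rewrite total_diff_inr ?total_diff_inl //; last 2 first.
- by move=> q; rewrite [LHS]tmapE cycleP tpure0r.
- by move=> p; rewrite [LHS]tmapE cycleP tpure0l.
rewrite [bver _ _ _ _ _]tmapE [bhor _ _ _ _ _]tmapE !ws_thetaP.
rewrite -[sincl _ (scaled_lift rb bhP)]/(r *: bh).
rewrite -[sincl _ (scaled_lift ra ahP)]/(r *: ah) !linearZ tpureZl tpureZr.
have -> : sgn R (i + 1) = - sgn R i by exact: sgnS.
rewrite [X in X + _ = _]scalerA mulNr -exprD addnn -mul2n exprM sqrrN !expr1n scaleN1r.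
exact: addNr.
Qed.

Definition M_cycle : cycles (tensor A B) (i + j + 1) := exist _ M_chain M_chain_cycle.
End MCycle.

End WeakSplitting.

(* Main.v *)
(** A weak splitting of [A] is the same thing as a free complex with
    Z_n (+) B_{n-1} in degree n and differential (z, w) |-> (w, 0), together with
    a quasi-isomorphism (gamma, theta) to [A]. Under the two quasi-isomorphisms
    for [A] and [B], M(a, r, b) is the image of the cycle
    (-1)^(i+1) a (x) r b + a r (x) b, so on the image of Tor the map mu comes
    from pairs of w in B_i (x) Z_j and v in Z_i (x) B_j with the same image in
    Z_i (x) Z_j, and beta(mu t) = t can be read off there.

    The value of beta does not depend on the free complexes used to compute it.
    Any two free complexes quasi-isomorphic to [A] map over [A] to one F -> A
    that is moreover surjective, and similarly G -> B. Then
    H(F (x) G) -> H(A (x) B) is injective: the kernel K of F -> A is a free exact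
    complex, hence contractible, and the kernel of K (x) B -> F (x) B is A * B,
    which is acyclic by assumption; likewise for F (x) G -> F (x) B, where the
    torsion term vanishes. *)

Require Import Defs.
From mathcomp Require Import all_boot all_algebra.
From mathcomp Require Import boolp wochoice freeg zify.

Set Implicit Arguments.
Unset Strict Implicit.
Unset Printing Implicit Defensive.

Import GRing.Theory.
Local Open Scope ring_scope.

(** * Submodules of free modules over a principal ideal domain *)

(** The torsion product is encoded as a kernel inside a tensor product and comes with no
    presentation by elementary tors and relations among them. A map out of it therefore cannot be
    prescribed on the tors <a, r, b>: [mu] arises from a linear, total and single-valued relation,
    and its value on an elementary tor is computed afterwards. Complexes are unbounded in both
    directions, so contractions and comparison maps cannot be built by induction on the degree. They
    come from splitting each free chain module into cycles and lifted boundaries, which works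
    because submodules of free modules over a principal ideal domain are free. Resolutions
    surjective onto [A] and [B] are preferred for two reasons: maps lift along them strictly, not
    merely up to homotopy, and in each degree p the sequence 0 -> K_p -> F_p -> A_p -> 0 is a free
    resolution, from which the torsion product can be computed. *)

Lemma inj_surj_bijective (T U : Type) (f : T -> U) :
  injective f -> (forall y, exists x, f x = y) -> bijective f.
Proof.
move=> finj /(_ _)/cid fsurj; exists (fun y => sval (fsurj y)) => x.
  by apply: finj; case: (fsurj _).
by case: (fsurj _).
Qed.

Lemma linear0_inj (R : comNzRingType) (U V : lmodType R) (f : {linear U -> V}) :
  (forall x, f x = 0 -> x = 0) -> injective f.
Proof.
by move=> f0 x y /eqP; rewrite -subr_eq0 -linearB => /eqP /f0 /subr0_eq.
Qed.

Lemma freem_expand (R : comNzRingType) (T : choiceType) (x : freem R T) :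
  x = \sum_(t <- dom x) coeff t x *: fgen R t.
Proof.
rewrite -[LHS]freeg_sumE; apply: eq_bigr => t _.
by apply/eqP/freeg_eqP=> u; rewrite coeffZ !coeffU mul1r.
Qed.

Lemma sincl_surj (R : comNzRingType) (V : lmodType R) (S : submodule V) x :
  x \in smem S -> exists y, sincl S y = x.
Proof. by move=> xS; exists (exist _ x xS : subm S). Qed.

Section Projectivity.
Variables (R : comNzRingType) (M N : lmodType R).

(** Projectivity with a linear relation in place of a surjection, so that a lift can meet several
    conditions at once: values are chosen on a basis and the conditions spread by linearity. *)
Lemma free_lift_rel (S : M -> N -> Prop) : free_module M ->
  S 0 0 ->
  (forall a m n m' n', S m n -> S m' n' -> S (a *: m + m') (a *: n + n')) ->
  (forall m, exists n, S m n) ->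
  exists h : {linear M -> N}, forall m, S m (h m).
Proof.
move=> [T [h [k hK kK]]] S0 Slin /(_ _)/cid Sex.
have k_lin : linear k.
  by move=> a x y; apply: (can_inj hK); rewrite linearP !kK.
pose l := flift (fun t => sval (Sex (h (fgen R t)))).
exists (l \o mk_linear k_lin) => m /=.
suff: S (h (k m)) (l (k m)) by rewrite kK.
elim/freem_ind: (k m) => [|a t x IHx]; first by rewrite !linear0.
by rewrite !linearP; apply: Slin => //; rewrite /l fliftE; case: (Sex _).
Qed.

(** Single-valuedness replaces freeness: chosen values are forced to be linear. This is how [mu] is
    defined on a torsion product, which is not free in general. *)
Lemma linear_of_rel (S : M -> N -> Prop) :
  (forall a m n m' n', S m n -> S m' n' -> S (a *: m + m') (a *: n + n')) ->
  (forall m, exists n, S m n) -> (forall m n n', S m n -> S m n' -> n = n') ->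
  exists h : {linear M -> N}, forall m, S m (h m).
Proof.
move=> Slin /(_ _)/cid Sex Sfun.
have h_lin : linear (fun m => sval (Sex m)).
  move=> a x y; apply: (Sfun (a *: x + y)); first by case: (Sex _).
  by apply: Slin; case: (Sex _).
by exists (mk_linear h_lin) => m /=; case: (Sex m).
Qed.

End Projectivity.

Lemma free_lift (R : comNzRingType) (M N P : lmodType R) (g : {linear N -> P})
    (f : {linear M -> P}) :
  free_module M -> (forall m, exists n, g n = f m) ->
  exists h : {linear M -> N}, forall m, g (h m) = f m.
Proof.
move=> Mfree gf; apply: (free_lift_rel (S := fun m n => g n = f m)) => //.
  by rewrite !linear0.
by move=> a m n m' n' mn mn'; rewrite !linearP mn mn'.
Qed.

Lemma freem_free (R : comNzRingType) (T : choiceType) : free_module (freem R T).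
Proof. by exists T, (lin_id (freem R T)); exists id. Qed.

Lemma free_module_iso (R : comNzRingType) (M N : lmodType R)
    (f : {linear M -> N}) : bijective f -> free_module M -> free_module N.
Proof.
move=> fbij [T [h hbij]]; exists T, (f \o h); exact: bij_comp.
Qed.

Section Dedekind.
Variables (R : idomainType) (R_pid : principal_ideal_ring R).

Section Freem.
Variables (T : choiceType) (S : submodule (freem R T)).

Let le : rel T := sval (@well_ordering_principle T).
Let le_wo : well_order le := svalP (@well_ordering_principle T).

Let le_chain : wo_chain le predT.
Proof. by move=> A _; exact: le_wo. Qed.
Let le_refl t : le t t. Proof. exact: (wo_chain_reflexive le_chain). Qed.
Let le_total t u : le t u || le u t. Proof. exact: (wo_chainW le_chain). Qed.
Let le_anti t u : le t u -> le u t -> t = u.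
Proof.
by move=> tu ut; apply: (wo_chain_antisymmetric le_chain) => //; rewrite tu ut.
Qed.

Let bounded (x : freem R T) t := forall u, coeff u x != 0 -> le u t.

Let seq_max (T' : eqType) (f : T' -> T) (s : seq T') :
  s != [::] -> exists2 t, t \in s & forall u, u \in s -> le (f u) (f t).
Proof.
(* Transitivity is read off the least element of [[:: x; y; z]] together with antisymmetry. *)
have le_trans : transitive le.
  move=> y x z xy yz; have [] := le_wo (A := mem [:: x; y; z]).
    by exists x; rewrite !inE eqxx.
  move=> m [[]]; rewrite !inE => /or3P[]/eqP-> mlb _.
  - by apply: mlb; rewrite !inE eqxx !orbT.
  - have xy' : le y x by apply: mlb; rewrite !inE eqxx.
    by rewrite (le_anti xy xy').
  - have zy : le z y by apply: mlb; rewrite !inE eqxx orbT.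
    by rewrite -(le_anti yz zy).
elim: s => // t [|u s] IHs _.
  by exists t; rewrite ?inE // => u; rewrite inE => /eqP->.
have [//|m ms mmax] := IHs; case/orP: (le_total (f t) (f m)) => tm.
  by exists m => [|v /predU1P[->|/mmax]] //; rewrite in_cons ms orbT.
exists t; rewrite ?mem_head // => v /predU1P[->//|/mmax vm].
exact: le_trans tm.
Qed.

(** Leading coefficients at [t] of the elements of [S] supported on indices up to [t]. This ideal is
    generated by [lead t], a value attained by [leader t]; the leaders with nonzero generator,
    indexed by [J], will form a basis of [S]. *)
Let lead_ideal t : {pred R^o} := fun c =>
  `[< exists s, [/\ s \in smem S, bounded s t & coeff t s = c] >].

Let coeffP (t : T) (a : R) (x y : freem R T) :
  coeff t (a *: x + y) = a * coeff t x + coeff t y.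
Proof. by rewrite coeffD coeffZ. Qed.

Let bounded_lin a x y t : bounded x t -> bounded y t -> bounded (a *: x + y) t.
Proof.
move=> xt yt u; rewrite coeffP.
case: (eqVneq (coeff u x) 0) => [->|/xt //].
by rewrite mulr0 add0r => /yt.
Qed.

Let lead_ideal_closed t : submod_closed (lead_ideal t).
Proof.
split=> [|a x y].
  apply/asboolP; exists 0; split; rewrite ?rpred0 ?coeff0 // => u.
  by rewrite coeff0 eqxx.
move=> /asboolP[s [sS st <-]] /asboolP[s' [sS' st' <-]]; apply/asboolP.
exists (a *: s + s'); split; rewrite ?rpredD ?rpredZ ?coeffP //.
exact: bounded_lin.
Qed.

Let lead t : {d : R | forall x, x \in lead_ideal t <-> exists c, x = c * d} :=
  cid (R_pid (lead_ideal_closed t)).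

Let leader t :
  {s | [/\ s \in smem S, bounded s t & coeff t s = sval (lead t)]}.
Proof.
apply/cid/asboolP; case: (lead t) => d dP.
by apply: (dP d).2; exists 1; rewrite mul1r.
Qed.

Let J : choiceType := {t : T | sval (lead t) != 0}.

Let leader_in (t : J) : sval (leader (val t)) \in smem S.
Proof. by case: (leader _) => ? []. Qed.

Let h : {linear freem R J -> subm S} :=
  flift (fun t : J => exist _ (sval (leader (val t))) (leader_in t) : subm S).

(* Leading coefficients: the greatest index of [x] survives in [h x]. *)
Let h_inj : injective h.
Proof.
apply: linear0_inj => x hx; apply/eqP; rewrite -dom_eq0; apply/negPn/negP.
move=> /(seq_max val) [t tx tmax].
have: coeff (val t) (sincl _ (h x)) = coeff t x * sval (lead (val t)).
  rewrite {1}[x]freem_expand !linear_sum raddf_sum.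
  have genE z : sincl S (h (coeff z x *: fgen R z)) =
      coeff z x *: sval (leader (val z)) by rewrite !linearZ /h fliftE.
  rewrite (eq_bigr (fun z => coeff z x * coeff (val t) (sval (leader (val z))))).
    rewrite (bigD1_seq t) ?uniq_dom //=.
    rewrite [X in _ + X]big1_seq => [|z /andP[zt zx]].
      by rewrite addr0; case: (leader _) => s /= [_ _ ->].
    case: (leader _) => s /= [_ sz _].
    case: (eqVneq (coeff (val t) s) 0) => [->|/sz tz]; first exact: mulr0.
    by case/eqP: zt; apply/val_inj/le_anti => //; exact: tmax.
  by move=> z _; rewrite -coeffZ; congr (coeff _ _); exact: genE.
rewrite hx linear0 coeff0 => /esym/eqP; rewrite mulf_eq0.
by move: tx; rewrite mem_dom => /negPf ->; rewrite (negPf (valP t)).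
Qed.

(** Transfinite descent: at the least bound [t0] of a counterexample, subtracting a multiple of the
    leader removes the coefficient at [t0], so the remainder is a counterexample with a smaller
    bound. *)
Let h_surj_bounded t s : s \in smem S -> bounded s t ->
  exists x, sincl _ (h x) = s.
Proof.
pose A := [pred t | `[< exists s, [/\ s \in smem S, bounded s t &
  ~ exists x, sincl _ (h x) = s] >]].
move=> sS st; apply: contrapT => nx.
have [|t0 [[/asboolP[s0 [s0S s0t nx0]] t0min] _]] := le_wo (A := A).
  by exists t; apply/asboolP; exists s.
have [c sc] : exists c, coeff t0 s0 = c * sval (lead t0).
  by case: (lead t0) => d /= dP; apply/dP/asboolP; exists s0.
(* If [t0] is not in [J], its ideal is zero, the coefficient of [s0] at [t0] already vanishes, and
   nothing is subtracted. *)
pose y := if insub t0 is Some z then c *: fgen R (z : J) else 0.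
have hyS : sincl _ (h y) \in smem S by exact: sincl_in.
have [hyb hyc] : bounded (sincl _ (h y)) t0 /\ coeff t0 (sincl _ (h y)) = coeff t0 s0.
  rewrite /y; case: insubP => [z _ zt|/negPn/eqP d0].
    rewrite !linearZ /h fliftE -[sincl _ _]/(sval (leader (val z))) zt coeffZ sc.
    case: (leader t0) => s1 /= [_ s1b ->]; split=> // u.
    by rewrite coeffZ mulf_eq0 negb_or => /andP[_ /s1b].
  by rewrite !linear0 coeff0 sc d0 mulr0; split=> // u; rewrite coeff0 eqxx.
pose s1 := s0 - sincl _ (h y).
have s1S : s1 \in smem S by rewrite rpredB.
have s1b : bounded s1 t0.
  by rewrite /s1 addrC -scaleN1r; exact: bounded_lin.
have s1t : coeff t0 s1 = 0 by rewrite coeffB hyc subrr.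
have s1x : ~ exists x, sincl _ (h x) = s1.
  move=> [x hx]; apply: nx0; exists (x + y).
  by rewrite !linearD hx /s1 subrK.
case: (eqVneq s1 0) => [s10|]; first by apply: s1x; exists 0; rewrite !linear0.
rewrite -dom_eq0 => /(seq_max id) [t1 t1s t1max].
have t1A : t1 \in A.
  apply/asboolP; exists s1; split=> // u; rewrite -mem_dom; exact: t1max.
have t10 : t1 = t0.
  by apply: le_anti; [apply: s1b; rewrite -mem_dom | exact: t0min].
by move: t1s; rewrite mem_dom t10 s1t eqxx.
Qed.

Lemma freem_submodule_free : free_module (subm S).
Proof.
exists J, h; apply: inj_surj_bijective => // s.
case: (eqVneq (sincl _ s) 0) => [s0|].
  by exists 0; apply: sincl_inj; rewrite !linear0 s0.
rewrite -dom_eq0 => /(seq_max id) [t ts tmax].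
have [|x] := @h_surj_bounded t (sincl _ s) (sincl_in s).
  by move=> u; rewrite -mem_dom; exact: tmax.
by move=> /sincl_inj; exists x.
Qed.

End Freem.

Theorem submodule_free (M : lmodType R) (S : submodule M) :
  free_module M -> free_module (subm S).
Proof.
move=> [T [h hbij]].
have cl : submod_closed [pred x | h x \in smem S].
  split=> [|a x y]; rewrite !inE ?linear0 ?rpred0 //.
  by move=> xS yS; rewrite linearP rpredD ?rpredZ.
pose S' := Submodule cl.
have hS (x : subm S') : (h \o sincl S') x \in smem S by exact: (sincl_in x).
apply: (free_module_iso (f := corestr hS)); last exact: freem_submodule_free.
apply: inj_surj_bijective => [x y /(congr1 (sincl S))|y].
  by rewrite !corestrE => /(bij_inj hbij) /(@sincl_inj _ _ S').
have [k hK kK] := hbij.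
have kS : k (sincl _ y) \in smem S' by rewrite inE kK sincl_in.
exists (exist _ (k (sincl _ y)) kS : subm S'); apply: sincl_inj.
by rewrite corestrE -[LHS]/(h (k _)) kK.
Qed.

End Dedekind.

(** * Exactness of the tensor product *)

Section TensorExactness.
Variable R : comNzRingType.

Lemma tens_ind (M N : lmodType R) (P : tens M N -> Prop) :
  P 0 -> (forall m n x, P x -> P (tpure m n + x)) -> forall x, P x.
Proof.
move=> P0 PS y; have [x <-] := qpi_surj y.
elim/freem_ind: x => [|a [m n] x IHx]; first by rewrite linear0.
by rewrite linearP -[qpi _ _]/(tpure m n) -tpureZl; apply: PS.
Qed.

Lemma tpureDl (M N : lmodType R) (m m' : M) (n : N) :
  tpure (m + m') n = tpure m n + tpure m' n.
Proof. by rewrite -[m]scale1r tpure_linl !scale1r. Qed.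

Lemma tpureDr (M N : lmodType R) (m : M) (n n' : N) :
  tpure m (n + n') = tpure m n + tpure m n'.
Proof. by rewrite -[n]scale1r tpure_linr !scale1r. Qed.

Lemma tpureBl (M N : lmodType R) (m m' : M) (n : N) :
  tpure (m - m') n = tpure m n - tpure m' n.
Proof. by rewrite tpureDl -scaleN1r tpureZl scaleN1r. Qed.

Lemma tpureBr (M N : lmodType R) (m : M) (n n' : N) :
  tpure m (n - n') = tpure m n - tpure m n'.
Proof. by rewrite tpureDr -scaleN1r tpureZr scaleN1r. Qed.

Lemma tmap_id (M N : lmodType R) x : tmap (lin_id M) (lin_id N) x = x.
Proof.
move: x; apply: (@tens_ext R M N _ (tmap (lin_id M) (lin_id N)) (lin_id _)).
by move=> m n; rewrite tmapE.
Qed.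

Lemma eq_tmap (M M' N N' : lmodType R) (f f' : {linear M -> M'})
    (g g' : {linear N -> N'}) :
  f =1 f' -> g =1 g' -> tmap f g =1 tmap f' g'.
Proof. by move=> ff' gg'; apply: tens_ext => m n; rewrite !tmapE ff' gg'. Qed.

Lemma tmap_surj (M M' N N' : lmodType R) (f : {linear M -> M'})
    (g : {linear N -> N'}) :
  (forall y, exists x, f x = y) -> (forall y, exists x, g x = y) ->
  forall y, exists x, tmap f g x = y.
Proof.
move=> fsurj gsurj; apply: tens_ind => [|m n y [x <-]].
  by exists 0; rewrite linear0.
have [m' <-] := fsurj m; have [n' <-] := gsurj n.
by exists (tpure m' n' + x); rewrite linearD tmapE.
Qed.

(* [tens M' N'] is the quotient of [tens M N] by the submodule generated by the
   [m (x) n] with [f m = 0] or [g n = 0]. *)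
Lemma tmap_kernel (M M' N N' : lmodType R) (f : {linear M -> M'})
    (g : {linear N -> N'}) (W : submodule (tens M N)) :
  (forall y, exists x, f x = y) -> (forall y, exists x, g x = y) ->
  (forall m n, f m = 0 \/ g n = 0 -> tpure m n \in smem W) ->
  forall x, tmap f g x = 0 -> x \in smem W.
Proof.
move=> /(_ _)/cid fs /(_ _)/cid gs W0 x gx0; apply/qpi_eq0.
have WE m m' n n' : f m = f m' -> g n = g n' ->
    qpi W (tpure m n) = qpi W (tpure m' n').
  move=> fm gn; apply/qpi_eqE.
  have -> : tpure m n - tpure m' n' = tpure (m - m') n + tpure m' (n - n').
    by rewrite tpureBl tpureBr addrA subrK.
  by rewrite rpredD // W0 // linearB ?fm ?gn subrr; [left | right].
pose b m' n' := qpi W (tpure (sval (fs m')) (sval (gs n'))).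
have bE m n : b (f m) (g n) = qpi W (tpure m n).
  by apply: WE; [case: (fs _) | case: (gs _)].
have bl a m m' n : b (a *: m + m') n = a *: b m n + b m' n.
  rewrite /b -linearP -tpure_linl; apply: WE => //.
  by rewrite linearP; case: (fs m) (fs m') (fs (_ + _)) => ? -> [? ->] [? ->].
have br a m n n' : b m (a *: n + n') = a *: b m n + b m n'.
  rewrite /b -linearP -tpure_linr; apply: WE => //.
  by rewrite linearP; case: (gs n) (gs n') (gs (_ + _)) => ? -> [? ->] [? ->].
have <- : tlift bl br (tmap f g x) = qpi W x.
  elim/tens_ind: x {gx0} => [|m n x IHx]; first by rewrite !linear0.
  by rewrite !linearD IHx tmapE tliftE bE.
by rewrite gx0 linear0.
Qed.

Section Image.
Variables (U V : lmodType R) (f : {linear U -> V}).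
Fact imm_closed : submod_closed [pred y | `[< exists x, f x = y >]].
Proof.
split=> [|a x y]; first by apply/asboolP; exists 0; rewrite linear0.
move=> /asboolP[u <-] /asboolP[v <-]; apply/asboolP; exists (a *: u + v).
exact: linearP.
Qed.
Definition imm : submodule V := Submodule imm_closed.
End Image.

(** Right exactness: the image of the left map contains the pure tensors that, by [tmap_kernel],
    generate the kernel. *)
Lemma tmap_exactr (M N N' N'' : lmodType R) (i : {linear N' -> N})
    (g : {linear N -> N''}) :
  (forall y, exists x, g x = y) ->
  (forall n, g n = 0 -> exists n', i n' = n) ->
  forall x, tmap (lin_id M) g x = 0 -> exists y, tmap (lin_id M) i y = x.
Proof.
move=> gs gi x gx0; suff: x \in smem (imm (tmap (lin_id M) i)) by move/asboolP.
apply: tmap_kernel gx0 => // [m|m n [m0|/gi[n' <-]]]; first by exists m.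
  by rewrite (_ : m = 0) // tpure0l rpred0.
by apply/asboolP; exists (tpure m n'); rewrite tmapE.
Qed.

Lemma tmap_exactl (M M' M'' N : lmodType R) (i : {linear M' -> M})
    (f : {linear M -> M''}) :
  (forall y, exists x, f x = y) ->
  (forall m, f m = 0 -> exists m', i m' = m) ->
  forall x, tmap f (lin_id N) x = 0 -> exists y, tmap i (lin_id N) y = x.
Proof.
move=> fs fi x fx0; suff: x \in smem (imm (tmap i (lin_id N))) by move/asboolP.
apply: tmap_kernel fx0 => // [n|m n [/fi[m' <-]|n0]]; first by exists n.
  by apply/asboolP; exists (tpure m' n); rewrite tmapE.
by rewrite (_ : n = 0) // tpure0r rpred0.
Qed.

Lemma freem_expand_seq (T : choiceType) (x : freem R T) (s : seq T) :
  uniq s -> {subset dom x <= s} -> x = \sum_(t <- s) coeff t x *: fgen R t.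
Proof.
move=> s_uniq xs; rewrite (bigID (mem (dom x))) /=.
rewrite [X in _ + X]big1 ?addr0 => [|t tx]; last by rewrite coeff_outdom ?scale0r.
rewrite {1}[x]freem_expand -big_filter; apply/perm_big/uniq_perm.
- exact: uniq_dom.
- exact: filter_uniq.
by move=> t; rewrite mem_filter /=; case: (boolP (t \in dom x)) => // /xs ->.
Qed.

(** A basis of [M] gives coefficient maps M (x) P -> P, natural in P, which together determine a
    tensor; injectivity of [g] is tested on each coefficient. *)
Lemma free_flat (M N N' : lmodType R) (g : {linear N -> N'}) :
  free_module M -> injective g -> injective (tmap (lin_id M) g).
Proof.
move=> [T [h [k hK kK]]] ginj; apply: linear0_inj.
have k_lin : linear k.
  by move=> a x y; apply: (can_inj hK); rewrite linearP !kK.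
pose cf (P : lmodType R) t (m : M) (n : P) := coeff t (k m) *: n.
have cfl P t a m m' n : cf P t (a *: m + m') n = a *: cf P t m n + cf P t m' n.
  by rewrite /cf k_lin coeffD coeffZ scalerDl scalerA.
have cfr P t a m n n' : cf P t m (a *: n + n') = a *: cf P t m n + cf P t m n'.
  by rewrite /cf scalerDr !scalerA mulrC.
pose coef P t := tlift (@cfl P t) (@cfr P t).
(* The expansion holds over every larger list, so that the two summands of a tensor can share
   one. *)
have expand (x : tens M N) : exists s : seq T, forall s', uniq s' -> {subset s <= s'} ->
    x = \sum_(t <- s') tpure (h (fgen R t)) (coef N t x).
  elim/tens_ind: x => [|m n x [s IHx]].
    by exists [::] => s' _ _; rewrite big1 // => t _; rewrite linear0 tpure0r.
  exists (dom (k m) ++ s) => s' s'_uniq ss'.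
  under eq_bigr do rewrite linearD tpureDr.
  rewrite big_split; congr (_ + _); last first.
    by apply: IHx => // t ts; rewrite ss' // mem_cat ts orbT.
  rewrite -{1}[m]kK (@freem_expand_seq _ (k m) s') // => [|t tm]; last first.
    by rewrite ss' // mem_cat tm.
  rewrite linear_sum (big_morph (fun m => tpure m n) (fun x y => tpureDl x y n)
    (tpure0l _ n)).
  by apply: eq_bigr => t _; rewrite linearZ tpureZl tliftE tpureZr.
move=> x gx0; have [s /(_ (undup s) (undup_uniq s)) ->] := expand x; last first.
  by move=> t; rewrite mem_undup.
rewrite big1 // => t _.
have coef_nat : g (coef N t x) = coef N' t (tmap (lin_id M) g x).
  elim/tens_ind: x {gx0} => [|m n x IHx]; first by rewrite !linear0.
  by rewrite !linearD IHx tmapE !tliftE /cf linearZ.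
suff -> : coef N t x = 0 by rewrite tpure0r.
by apply: ginj; rewrite coef_nat gx0 !linear0.
Qed.

(* On ker (S (x) N -> F (x) N), a map vanishes as soon as it extends to
   F (x) N; so only the map F / S -> F' / S' matters. *)
Lemma tmap_restr_indep (F F' : lmodType R) (S : submodule F) (S' : submodule F')
    (N N' : lmodType R) (phi psi : {linear F -> F'})
    (phiS : forall x, x \in smem S -> phi x \in smem S')
    (psiS : forall x, x \in smem S -> psi x \in smem S')
    (g : {linear N -> N'}) (t : tens (subm S) N) :
  (forall x, phi x - psi x \in smem S') ->
  tmap (sincl S) (lin_id N) t = 0 ->
  tmap (restr phiS) g t = tmap (restr psiS) g t.
Proof.
move=> diffS t0; apply/eqP; rewrite -subr_eq0; apply/eqP.
pose d : {linear F -> F'} := phi \- psi.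
have dS x : d x \in smem S' by exact: diffS.
rewrite -[RHS](linear0 (tmap (corestr dS) g)) -t0.
elim/tens_ind: t {t0} => [|m n t IHt]; first by rewrite !linear0 addr0.
rewrite !linearD -IHt addrACA; congr (_ + _).
rewrite !tmapE -tpureBl; congr tpure; apply: sincl_inj.
by rewrite linearB !corestrE.
Qed.

Lemma free_module_prod (M N : lmodType R) :
  free_module M -> free_module N -> free_module (M * N)%type.
Proof.
move=> [T [h hbij]] [U [k kbij]].
have l_lin : linear (fun m : M => (m, 0) : (M * N)%type).
  by move=> a x y; congr pair; rewrite /= scaler0 addr0.
have r_lin : linear (fun n : N => (0, n) : (M * N)%type).
  by move=> a x y; congr pair; rewrite /= scaler0 addr0.
pose f (x : T + U) : (M * N)%type :=
  match x with inl t => (h (fgen R t), 0) | inr u => (0, k (fgen R u)) end.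
have fl (x : freem R T) :
    flift f (flift (fun t => fgen R (inl t : (T + U)%type)) x) = (h x, 0).
  elim/freem_ind: x => [|a t x IHx]; first by rewrite !linear0.
  by rewrite !linearP IHx !fliftE -l_lin.
have fr (x : freem R U) :
    flift f (flift (fun t => fgen R (inr t : (T + U)%type)) x) = (0, k x).
  elim/freem_ind: x => [|a t x IHx]; first by rewrite !linear0.
  by rewrite !linearP IHx !fliftE -r_lin.
have [h' hK kK] := hbij; have [k' hK' kK'] := kbij.
exists (T + U)%type, (flift f); apply: inj_surj_bijective; last first.
  move=> [m n]; exists (flift (fun t => fgen R (inl t : (T + U)%type)) (h' m) +
    flift (fun t => fgen R (inr t : (T + U)%type)) (k' n)).
  by rewrite linearD fl fr kK kK'; congr pair; rewrite /= ?addr0 ?add0r.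
apply: linear0_inj => x fx0.
pose pl (x : T + U) : freem R T := if x is inl t then fgen R t else 0.
pose pr (x : T + U) : freem R U := if x is inr t then fgen R t else 0.
have hpl y : h (flift pl y) = (flift f y).1.
  elim/freem_ind: y => [|a t y IHy]; first by rewrite !linear0.
  rewrite !linearP IHy !fliftE; congr (_ *: _ + _).
  by case: t => t; rewrite ?linear0.
have kpr y : k (flift pr y) = (flift f y).2.
  elim/freem_ind: y => [|a t y IHy]; first by rewrite !linear0.
  rewrite !linearP IHy !fliftE; congr (_ *: _ + _).
  by case: t => t; rewrite ?linear0.
have xE y : y = flift (fun t => fgen R (inl t : (T + U)%type)) (flift pl y) +
    flift (fun t => fgen R (inr t : (T + U)%type)) (flift pr y).
  elim/freem_ind: y => [|a t y IHy]; first by rewrite !linear0 addr0.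
  rewrite {1}IHy !linearP addrACA -scalerDr; congr (_ *: _ + _).
  case: t => t; rewrite !(fliftE pl, fliftE pr) [pl _]/= [pr _]/= linear0 fliftE.
    by rewrite addr0.
  by rewrite add0r.
rewrite [x]xE; have -> : flift pl x = 0.
  by apply: (bij_inj hbij); rewrite hpl fx0; exact/esym/linear0.
have -> : flift pr x = 0.
  by apply: (bij_inj kbij); rewrite kpr fx0; exact/esym/linear0.
by rewrite !linear0 addr0.
Qed.

End TensorExactness.

(** * Chain complexes and total complexes *)

Section Complexes.
Variable R : comNzRingType.
Implicit Types C D : complex R.

(** Quantifying over all target degrees avoids transport between equal degrees such as n and n - 1 +
    1; the equation [m = n + 1] in [exact_complex] serves the same end. *)
Definition is_cycle C n (x : C n) : Prop := forall k, cdiff C n k x = 0.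

Definition exact_complex C : Prop := forall n m (x : C n),
  m = n + 1 -> is_cycle x -> exists y : C m, cdiff C m n y = x.

Lemma cycle_is_cycle C n (z : cycles C n) : is_cycle (sincl _ z).
Proof. by move=> k; exact: cycleP. Qed.

Lemma cycle_of C n (x : C n) :
  cdiff C n (n - 1) x = 0 -> exists z : cycles C n, sincl _ z = x.
Proof.
move=> x0; have xc : x \in smem (cyc C n) by apply/kermP.
by exists (exist _ x xc : cycles C n).
Qed.

Lemma hclass_eq0 C n (z : cycles C n) :
  hclass C n z = 0 <-> exists y, cdiff C (n + 1) n y = sincl _ z.
Proof. by rewrite qpi_eq0; split=> /asboolP. Qed.

Lemma acyclic_exact C : acyclic C -> exact_complex C.
Proof.
move=> Cac n m x -> xc; have [z zx] := cycle_of (xc (n - 1)).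
by rewrite -zx; apply/hclass_eq0/Cac.
Qed.

Lemma hmapE C D (f : chain_map C D) n z :
  hmap f n (hclass C n z) = hclass D n (cyc_map f n z).
Proof. by rewrite /hmap [LHS]qdescE. Qed.

Lemma hmap_eq0 C D (f : chain_map C D) n (z : cycles C n) :
  hmap f n (hclass C n z) = 0 <->
  exists y, cdiff D (n + 1) n y = f n (sincl _ z).
Proof. by rewrite hmapE hclass_eq0. Qed.

Lemma quasi_iso_bounds C D (f : chain_map C D) n m (x : C n) (y : D m) :
  quasi_iso f -> m = n + 1 -> is_cycle x -> cdiff D m n y = f n x ->
  exists x' : C m, cdiff C m n x' = x.
Proof.
move=> fqi mE xc; subst m => yx; have [z zx] := cycle_of (xc (n - 1)).
rewrite -zx; apply/hclass_eq0/(bij_inj (fqi n)); rewrite linear0.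
by apply/hmap_eq0; exists y; rewrite yx -zx.
Qed.

Lemma quasi_iso_cycle C D (f : chain_map C D) n m (y : D n) :
  quasi_iso f -> m = n + 1 -> is_cycle y ->
  exists (x : C n) (a : D m), is_cycle x /\ f n x = y + cdiff D m n a.
Proof.
move=> fqi mE yc; subst m; have [z zy] := cycle_of (yc (n - 1)).
have [h' _ /(_ (hclass D n z)) hz] := fqi n.
have [x xh] := qpi_surj (h' (hclass D n z)).
have /hclass_eq0 : hclass D n (cyc_map f n x - z) = 0.
  by rewrite linearB -hmapE [hclass C n x]xh hz subrr.
move=> [a aE]; exists (sincl _ x), a; split; first by move=> k; exact: cycleP.
by rewrite aE linearB zy addrCA subrr addr0.
Qed.

Fact chain_id_subproof C n m x :
  lin_id (C m) (cdiff C n m x) = cdiff C n m (lin_id (C n) x).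
Proof. by []. Qed.
Definition chain_id C : chain_map C C :=
  @ChainMap R C C (fun n => lin_id (C n)) (@chain_id_subproof C).

Section KernelComplex.
Variables (C D : complex R) (f : chain_map C D).
Fact kerc_subproof n m x :
  x \in smem (kerm (f n)) -> cdiff C n m x \in smem (kerm (f m)).
Proof. by move=> /kermP fx; apply/kermP; rewrite cmapP fx linear0. Qed.
Definition kerc_diff n m : {linear subm (kerm (f n)) -> subm (kerm (f m))} :=
  restr (@kerc_subproof n m).
Fact kerc_shape n m : n != m + 1 -> kerc_diff n m =1 (fun=> 0).
Proof. by move=> nm x; apply: sincl_inj; rewrite corestrE [LHS]cdiff_shape. Qed.
Fact kerc_diffK n m k x : kerc_diff m k (kerc_diff n m x) = 0.
Proof. by apply: sincl_inj; rewrite linear0 !corestrE [LHS]cdiffK. Qed.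
Definition kerc : complex R := Complex kerc_shape kerc_diffK.

Fact kerc_incl_subproof n m x :
  sincl (kerm (f m)) (cdiff kerc n m x) = cdiff C n m (sincl (kerm (f n)) x).
Proof. by []. Qed.
Definition kerc_incl : chain_map kerc C :=
  @ChainMap R kerc C (fun n => sincl (kerm (f n))) kerc_incl_subproof.

Lemma kerc_inclP n x : f n x = 0 -> exists k, kerc_incl n k = x.
Proof. by move=> /kermP fx; exists (exist _ x fx : subm (kerm (f n))). Qed.

(** A cycle of the kernel bounds some [y] in [C] by injectivity on homology. Then [f m y] is a
    cycle, and surjectivity on homology allows [y] to be corrected by a cycle and a boundary until
    it lies in the kernel, with the same differential. *)
Lemma kerc_exact :
  (forall n y, exists x, f n x = y) -> quasi_iso f -> exact_complex kerc.
Proof.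
move=> fsurj fqi n m x mE xc.
have xc' : is_cycle (kerc_incl n x) by move=> k; rewrite -cmapP xc linear0.
have fx : f n (kerc_incl n x) = 0 by apply/kermP; exact: (sincl_in x).
have [|y yx] := @quasi_iso_bounds _ _ f n m (kerc_incl n x) 0 fqi mE xc'.
  by rewrite fx linear0.
have fyc : is_cycle (f m y).
  move=> k; rewrite -cmapP; case: (eqVneq k n) => [->|kn].
    by rewrite yx fx.
  by rewrite cdiff_shape ?linear0 //; lia.
have [c [a [cc ca]]] := quasi_iso_cycle fqi (erefl (m + 1)) fyc.
have [a' a'E] := fsurj _ a.
have [|k kE] := @kerc_inclP m (y - c + cdiff C (m + 1) m a').
  by rewrite linearD linearB cmapP a'E ca opprD addrA subrr add0r addNr.
exists k; apply: sincl_inj; rewrite -[LHS]/(cdiff C m n (kerc_incl m k)) kE.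
by rewrite linearD linearB cdiffK cc subr0 addr0.
Qed.

End KernelComplex.

(* Diagram chase along 0 -> ker i -> K -> C -> D -> 0. *)
Lemma exact_chase (K C D : complex R) (i : chain_map K C) (f : chain_map C D) :
  (forall n y, exists x, f n x = y) ->
  (forall n x, f n x = 0 -> exists k, i n k = x) ->
  exact_complex K ->
  (forall n m (x : K n), m = n + 1 -> is_cycle x -> i n x = 0 ->
     exists y : K m, i m y = 0 /\ cdiff K m n y = x) ->
  forall n m (x : C n) (y : D m), m = n + 1 -> is_cycle x ->
    cdiff D m n y = f n x -> exists x' : C m, cdiff C m n x' = x.
Proof.
move=> fsurj fi Kex kex n m x y mE xc yx; have [y' y'E] := fsurj _ y.
have [|k kE] := fi n (x - cdiff C m n y').
  by rewrite linearB cmapP y'E yx subrr.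
have [|||s [s0 sE]] := kex (n - 1) n (cdiff K n (n - 1) k).
- by rewrite subrK.
- by move=> j; exact: cdiffK.
- by rewrite cmapP kE linearB xc cdiffK subr0.
have [|k' k'E] := Kex n m (k - s) mE.
  move=> j; rewrite linearB; case: (eqVneq j (n - 1)) => [->|jn].
    by rewrite sE subrr.
  by rewrite !cdiff_shape ?subr0 //; lia.
exists (i m k' + y'); rewrite linearD -cmapP k'E linearB s0 subr0 kE.
by rewrite subrK.
Qed.

End Complexes.

(** * Contractions of free exact complexes *)

Section Contraction.
Variables (R : idomainType) (R_pid : principal_ideal_ring R).

(** The cycles are free and all are boundaries, so the differential has a section [g] over them; 1 -
    g d retracts [K] onto its cycles, and the contraction is [g] after this retraction. *)
Lemma free_exact_contraction (K : complex R) : free_complex K -> exact_complex K ->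
  exists s : forall n m, {linear K n -> K m}, forall n x,
    cdiff K (n + 1) n (s n (n + 1) x) + s (n - 1) n (cdiff K n (n - 1) x) = x.
Proof.
move=> Kfree Kex.
(* Only m = n + 1 matters; for other pairs of degrees any map will do. *)
have sec n m : exists g : {linear cycles K n -> K m},
    m = n + 1 -> forall z, cdiff K m n (g z) = sincl _ z.
  case: (eqVneq m (n + 1)) => [mE|mn]; last by exists \0 => mE; lia.
  have [|z|g gE] := @free_lift R (cycles K n) _ _ (cdiff K m n) (sincl _).
  - exact: submodule_free.
  - by apply: Kex => // k; exact: cycleP.
  by exists g.
pose g n m := sval (cid (sec n m)).
have gE n m z : m = n + 1 -> cdiff K m n (g n m z) = sincl _ z.
  by rewrite /g; case: (cid _) => h /= hE mE; exact: hE.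
have bdP n m (x : K n) : cdiff K n m x \in smem (cyc K m).
  by apply/kermP; exact: cdiffK.
pose bd n m : {linear K n -> cycles K m} := corestr (@bdP n m).
have dg n m (x : K n) : n = m + 1 -> cdiff K n m (g m n (bd n m x)) = cdiff K n m x.
  by move=> nE; rewrite gE.
have retP n x : x - g (n - 1) n (bd n (n - 1) x) \in smem (cyc K n).
  by apply/kermP; rewrite linearB dg ?subrr // subrK.
have ret_lin n : linear (fun x => x - g (n - 1) n (bd n (n - 1) x)).
  by move=> a x y; rewrite !linearP addrACA -scalerDr.
pose ret n : {linear K n -> cycles K n} :=
  @corestr R (K n) (cyc K n) _ (mk_linear (ret_lin n)) (retP n).
exists (fun n m => g n m \o ret n) => n x.
rewrite -[s in s + _]/(cdiff K (n + 1) n (g n (n + 1) (ret n x))) gE // corestrE.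
rewrite -[s in s + _]/(x - g (n - 1) n (bd n (n - 1) x)).
rewrite -[s in _ + s]/(g (n - 1) n (ret (n - 1) (cdiff K n (n - 1) x))).
(* The differential of [x] is already a cycle, and the retraction fixes it. *)
suff -> : ret (n - 1) (cdiff K n (n - 1) x) = bd n (n - 1) x by rewrite subrK.
apply: sincl_inj; rewrite !corestrE.
rewrite -[LHS]/(cdiff K n (n - 1) x -
  g (n - 1 - 1) (n - 1) (bd (n - 1) (n - 1 - 1) (cdiff K n (n - 1) x))).
suff -> : bd (n - 1) (n - 1 - 1) (cdiff K n (n - 1) x) = 0 by rewrite linear0 subr0.
by apply: sincl_inj; rewrite corestrE linear0; exact: cdiffK.
Qed.

End Contraction.

(** * Total complexes, and their contraction along one direction *)

Section Totals.
Variable R : comNzRingType.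
Implicit Types D E : bicomplex R.

Lemma total_ext D n (x y : Defs.total D n) :
  (forall p q, sincl (totm D n) x (p, q) = sincl (totm D n) y (p, q)) -> x = y.
Proof.
by move=> xy; apply/sincl_inj/functional_extensionality_dep => -[p q].
Qed.

Lemma total_diffE' D n m (x : Defs.total D n) p q : n = m + 1 ->
  sincl (totm D m) (cdiff (Defs.total D) n m x) (p, q) =
  bhor D (p + 1) p q (sincl (totm D n) x (p + 1, q)) +
  sgn R p *: bver D p (q + 1) q (sincl (totm D n) x (p, q + 1)).
Proof.
by move=> nE; subst n; rewrite -[LHS]/(tot_dcomp m x (p, q)) /tot_dcomp eqxx tot_dfunE.
Qed.

Lemma total_degree D n (x : Defs.total D n) p q :
  p + q != n -> sincl (totm D n) x (p, q) = 0.
Proof. by have /asboolP[x0 _] := sincl_in x => pq; apply: x0. Qed.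

Lemma total_supp D n (x : Defs.total D n) : exists s : seq (int * int),
  forall p q, (p, q) \notin s -> sincl (totm D n) x (p, q) = 0.
Proof. by have /asboolP[_ [s xs]] := sincl_in x; exists s => p q /xs. Qed.

Lemma total_build D n (x : forall p q, D p q) (s : seq (int * int)) :
  (forall p q, p + q != n -> x p q = 0) ->
  (forall p q, (p, q) \notin s -> x p q = 0) ->
  exists y : Defs.total D n, forall p q, sincl (totm D n) y (p, q) = x p q.
Proof.
move=> xn xs; pose x' : bfam D := fun pq => x pq.1 pq.2.
have x'P : x' \in smem (totm D n).
  by apply/asboolP; split=> [[p q] /xn|] //; exists s => -[p q] /xs.
by exists (exist _ x' x'P : Defs.total D n).
Qed.

Lemma total_lift D E (f : forall p q, {linear D p q -> E p q}) n (y : Defs.total E n) :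
  (forall p q, exists x, f p q x = sincl (totm E n) y (p, q)) ->
  exists x : Defs.total D n, forall p q,
    f p q (sincl (totm D n) x (p, q)) = sincl (totm E n) y (p, q).
Proof.
move=> fy.
(* Zero components are lifted to zero, so the lift keeps the degree and the finite support of
   [y]. *)
have fy0 p q : exists x, f p q x = sincl (totm E n) y (p, q) /\
    (sincl (totm E n) y (p, q) = 0 -> x = 0).
  case: (pselect (sincl (totm E n) y (p, q) = 0)) => [->|yn0].
    by exists 0; rewrite linear0.
  by have [x xE] := fy p q; exists x.
pose x p q := sval (cid (fy0 p q)).
have xP p q : f p q (x p q) = sincl (totm E n) y (p, q) /\
    (sincl (totm E n) y (p, q) = 0 -> x p q = 0) := svalP (cid (fy0 p q)).
have [s ys] := total_supp y.
have [||z zx] := @total_build D n x s.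
- by move=> p q /(total_degree y)/(xP p q).2.
- by move=> p q /ys/(xP p q).2.
by exists z => p q; rewrite zx (xP p q).1.
Qed.

Lemma total_cycle D n (x : Defs.total D n) p q : is_cycle x ->
  bhor D (p + 1) p q (sincl (totm D n) x (p + 1, q)) =
  - sgn R p *: bver D p (q + 1) q (sincl (totm D n) x (p, q + 1)).
Proof.
move=> /(_ (n - 1)) xc; apply/eqP; rewrite scaleNr -addr_eq0.
by rewrite -(@total_diffE' D n (n - 1)) ?xc ?subrK // linear0.
Qed.

Lemma sgnK p : sgn R p * sgn R p = 1.
Proof. by rewrite -exprD addnn -mul2n exprM sqrrN !expr1n. Qed.

(** Applying [s] to a cycle gives a primitive: [s] commutes with [bver], so by the cycle condition
    the vertical part of the boundary is exactly the missing term [s (bhor x)]. *)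
Lemma contract_hor D (s : forall p p' q, {linear D p q -> D p' q}) :
  (forall p q x, bhor D (p + 1) p q (s p (p + 1) q x) +
     s (p - 1) p q (bhor D p (p - 1) q x) = x) ->
  (forall p p' q q' x, bver D p' q q' (s p p' q x) = s p p' q' (bver D p q q' x)) ->
  exact_complex (Defs.total D).
Proof.
move=> hs vs n m x mE xc; have [t xt] := total_supp x.
have [||y yE] := @total_build D m
    (fun p q => s (p - 1) p q (sincl (totm D n) x (p - 1, q)))
    [seq (i.1 + 1, i.2) | i <- t].
- by move=> p q pq; rewrite total_degree ?linear0 //; lia.
- move=> p q pq; rewrite xt ?linear0 //; apply: contra pq => pq.
  by apply/mapP; exists (p - 1, q) => //=; rewrite subrK.
exists y; apply: total_ext => p q; rewrite (total_diffE' y) // !yE vs addrK.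
rewrite -[RHS]hs; congr (_ + _).
have := total_cycle (p - 1) q xc; rewrite subrK => ->; rewrite linearZ.
by rewrite -[p in sgn R p](subrK 1) sgnS.
Qed.

Lemma contract_ver D (s : forall p q q', {linear D p q -> D p q'}) :
  (forall p q x, bver D p (q + 1) q (s p q (q + 1) x) +
     s p (q - 1) q (bver D p q (q - 1) x) = x) ->
  (forall p p' q q' x, bhor D p p' q' (s p q q' x) = s p' q q' (bhor D p p' q x)) ->
  exact_complex (Defs.total D).
Proof.
move=> vs hs n m x mE xc; have [t xt] := total_supp x.
(* The factor [sgn R p] offsets the sign that the total differential puts on [bver]. *)
have [||y yE] := @total_build D m
    (fun p q => sgn R p *: s p (q - 1) q (sincl (totm D n) x (p, q - 1)))
    [seq (i.1, i.2 + 1) | i <- t].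
- by move=> p q pq; rewrite total_degree ?linear0 ?scaler0 //; lia.
- move=> p q pq; rewrite xt ?linear0 ?scaler0 //; apply: contra pq => pq.
  by apply/mapP; exists (p, q - 1) => //=; rewrite subrK.
exists y; apply: total_ext => p q; rewrite (total_diffE' y) // !yE !linearZZ hs.
rewrite addrK scalerA sgnK scale1r -[RHS]vs addrC; congr (_ + _).
have := total_cycle p (q - 1) xc; rewrite subrK => ->; rewrite linearZ.
by rewrite sgnS scalerA mulrNN sgnK scale1r.
Qed.

End Totals.

(** * Tensor products of surjective quasi-isomorphisms *)

Lemma restr_comp (R : comNzRingType) (F F' F'' : lmodType R) (S : submodule F)
    (S' : submodule F') (S'' : submodule F'')
    (f : {linear F -> F'}) (g : {linear F' -> F''}) (h : {linear F -> F''})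
    (fS : forall x, x \in smem S -> f x \in smem S')
    (gS : forall x, x \in smem S' -> g x \in smem S'')
    (hS : forall x, x \in smem S -> h x \in smem S'') :
  g \o f =1 h -> restr gS \o restr fS =1 restr hS.
Proof. by move=> gf x; apply: sincl_inj; rewrite [RHS]corestrE /= -gf. Qed.

Section TensorExact.
Variables (R : idomainType) (R_pid : principal_ideal_ring R).

Lemma tensor_exactl (K B : complex R) :
  free_complex K -> exact_complex K -> exact_complex (tensor K B).
Proof.
move=> Kfree Kex; have [s sE] := free_exact_contraction R_pid Kfree Kex.
apply: (@contract_hor _ (tensor_bicomplex K B)
  (fun p p' q => tmap (s p p') (lin_id (B q)))).
  move=> p q; elim/tens_ind=> [|m n x IHx]; first by rewrite !linear0 addr0.
  rewrite !linearD addrACA IHx; congr (_ + _).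
  rewrite tmapE [X in X + _]tmapE [X in tmap _ _ X]tmapE [X in _ + X]tmapE.
  by rewrite -tpureDl sE.
move=> p p' q q'; elim/tens_ind=> [|m n x IHx]; first by rewrite !linear0.
rewrite !linearD IHx; congr (_ + _).
by rewrite tmapE [LHS]tmapE [X in tmap _ _ X]tmapE [RHS]tmapE.
Qed.

Lemma tensor_exactr (F K : complex R) :
  free_complex K -> exact_complex K -> exact_complex (tensor F K).
Proof.
move=> Kfree Kex; have [s sE] := free_exact_contraction R_pid Kfree Kex.
apply: (@contract_ver _ (tensor_bicomplex F K)
  (fun p q q' => tmap (lin_id (F p)) (s q q'))).
  move=> p q; elim/tens_ind=> [|m n x IHx]; first by rewrite !linear0 addr0.
  rewrite !linearD addrACA IHx; congr (_ + _).
  rewrite tmapE [X in X + _]tmapE [X in tmap _ _ X]tmapE [X in _ + X]tmapE.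
  by rewrite -tpureDr sE.
move=> p p' q q'; elim/tens_ind=> [|m n x IHx]; first by rewrite !linear0.
rewrite !linearD IHx; congr (_ + _).
by rewrite tmapE [LHS]tmapE [X in tmap _ _ X]tmapE [RHS]tmapE.
Qed.

Lemma tensor_map_surj (A A' B B' : complex R) (f : chain_map A A')
    (g : chain_map B B') :
  (forall n y, exists x, f n x = y) -> (forall n y, exists x, g n x = y) ->
  forall n y, exists x, tensor_map f g n x = y.
Proof.
move=> fs gs n y.
have [p q|x xE] := @total_lift _ _ _ (tensor_map_comp f g) n y.
  exact: tmap_surj.
by exists x; apply: total_ext.
Qed.

(** * The torsion complex as the kernel of K (x) B -> F (x) B *)

Section TorsionKernel.
Variables (A B F : complex R) (f : chain_map F A).
Hypotheses (Ffree : free_complex F) (fsurj : forall n y, exists x, f n x = y).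
Local Notation K := (kerc f).
Local Notation i := (tensor_map (kerc_incl f) (chain_id B)).

Let lam_ex p : exists l : {linear freem R (A p) -> F p},
  forall x, f p (l x) = std_aug (A p) x.
Proof. by apply: free_lift => //; exact: freem_free. Qed.
Let lam p := sval (cid (lam_ex p)).
Let lamE p x : f p (lam p x) = std_aug (A p) x := svalP (cid (lam_ex p)) x.

Let kap_ex p : exists k : {linear F p -> freem R (A p)},
  forall x, std_aug (A p) (k x) = f p x.
Proof. by apply: free_lift => // x; exists (fgen R (f p x)); rewrite fliftE. Qed.
Let kap p := sval (cid (kap_ex p)).
Let kapE p x : std_aug (A p) (kap p x) = f p x := svalP (cid (kap_ex p)) x.

Let lamS p x : x \in smem (std_rel (A p)) -> lam p x \in smem (kerm (f p)).
Proof. by move=> /kermP x0; apply/kermP; rewrite lamE. Qed.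
Let kapS p x : x \in smem (kerm (f p)) -> kap p x \in smem (std_rel (A p)).
Proof. by move=> /kermP x0; apply/kermP; rewrite kapE. Qed.

(** Comparison of the standard resolution of A_p with 0 -> K_p -> F_p -> A_p -> 0. It identifies the
    torsion product with the kernel of K_p (x) B_q -> F_p (x) B_q: [lam] and [kap] are inverse to
    each other modulo relations, which is enough by [tmap_restr_indep]. *)
Let psi p q : {linear tor (A p) (B q) -> tensor_bicomplex K B p q} :=
  sincl _ \o tor_res_map (@lamS p) (lin_id (B q)).

Let psiE p q t : psi p q t = tmap (restr (@lamS p)) (lin_id (B q)) (sincl _ t).
Proof. by []. Qed.

Let tor_ker (M N : lmodType R) (t : tor M N) :
  tmap (sincl (std_rel M)) (lin_id N) (sincl _ t) = 0.
Proof. exact/kermP/(sincl_in t). Qed.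

Let psi_ker p q t : tmap (sincl (kerm (f p))) (lin_id (B q)) (psi p q t) = 0.
Proof. exact/kermP/(sincl_in (tor_res_map (@lamS p) (lin_id (B q)) t)). Qed.

Let id_closed (V : lmodType R) (S : submodule V) x :
  x \in smem S -> lin_id V x \in smem S.
Proof. by []. Qed.

Let restr_id (V N : lmodType R) (S : submodule V) (x : tens (subm S) N) :
  tmap (restr (@id_closed V S)) (lin_id N) x = x.
Proof.
by rewrite -[RHS]tmap_id; apply: eq_tmap => // y; apply: sincl_inj.
Qed.

Let lamkapS p x : x \in smem (kerm (f p)) -> (lam p \o kap p) x \in smem (kerm (f p)).
Proof. by move=> /kapS/lamS. Qed.
Let kaplamS p x :
  x \in smem (std_rel (A p)) -> (kap p \o lam p) x \in smem (std_rel (A p)).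
Proof. by move=> /lamS/kapS. Qed.

Let psi_surj p q (x : tens (subm (kerm (f p))) (B q)) :
  tmap (sincl (kerm (f p))) (lin_id (B q)) x = 0 -> exists t, psi p q t = x.
Proof.
move=> x0; have xP : x \in smem (kerm (tmap (sincl (kerm (f p))) (lin_id (B q)))).
  exact/kermP.
pose x' : tor_res (kerm (f p)) (B q) := exist _ x xP.
exists (tor_res_map (@kapS p) (lin_id (B q)) x').
rewrite psiE -[sincl _ _]/(tmap (restr (@kapS p)) (lin_id (B q)) x).
rewrite (tmap_comp (f2 := restr (@lamkapS p)) (g2 := lin_id (B q))) //;
  last exact: restr_comp.
rewrite -[RHS]restr_id; apply: tmap_restr_indep => // y.
by apply/kermP; rewrite linearB [f p (_ y)]lamE kapE subrr.
Qed.

Let psi_inj p q t : psi p q t = 0 -> t = 0.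
Proof.
move=> t0; apply: sincl_inj; rewrite linear0.
rewrite -(linear0 (tmap (restr (@kapS p)) (lin_id (B q)))) -t0 psiE.
rewrite (tmap_comp (f2 := restr (@kaplamS p)) (g2 := lin_id (B q))) //;
  last exact: restr_comp.
rewrite -[LHS]restr_id; apply: tmap_restr_indep; last exact: tor_ker.
by move=> y; apply/kermP; rewrite linearB [X in _ - X]kapE lamE subrr.
Qed.

(** The family [lam] need not commute with differentials; the defect has values in the kernel of [f]
    and is therefore invisible on the torsion product. *)
Let psi_hor p p' q t :
  psi p' q (bhor (torsion_bicomplex A B) p p' q t) =
  bhor (tensor_bicomplex K B) p p' q (psi p q t).
Proof.
have h1 x : x \in smem (std_rel (A p)) ->
    (lam p' \o std_map (cdiff A p p')) x \in smem (kerm (f p')).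
  by move=> xS; apply/lamS; exact: std_map_rel.
have h2 x : x \in smem (std_rel (A p)) ->
    (cdiff F p p' \o lam p) x \in smem (kerm (f p')).
  by move=> /lamS xS; exact: (kerc_subproof (f := f)  p' xS).
rewrite psiE [LHS](tmap_comp (f2 := restr h1) (g2 := lin_id (B q))) //;
  last exact: restr_comp.
rewrite psiE [RHS](tmap_comp (f2 := restr h2) (g2 := lin_id (B q))) //;
  last exact: restr_comp.
apply: tmap_restr_indep; last exact: tor_ker.
move=> y; apply/kermP; rewrite linearB [X in X - _]lamE std_aug_map.
by rewrite -[X in f p' X]/(cdiff F p p' (lam p y)) cmapP lamE subrr.
Qed.

Let psi_ver p q q' t :
  psi p q' (bver (torsion_bicomplex A B) p q q' t) =
  bver (tensor_bicomplex K B) p q q' (psi p q t).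
Proof.
rewrite psiE.
rewrite [LHS](tmap_comp (f2 := restr (@lamS p)) (g2 := cdiff B q q')) //.
  by rewrite psiE [RHS](tmap_comp (f2 := restr (@lamS p)) (g2 := cdiff B q q')).
apply: restr_comp => x; congr (lam p _).
by elim/freem_ind: x => [|a y x IHx]; rewrite ?linear0 // !linearP IHx fliftE.
Qed.

Let Psi : chain_map (torsion A B) (tensor K B) := tot_map psi_hor psi_ver.

Lemma tensor_kernel_exact : acyclic (torsion A B) ->
  forall n m (x : tensor K B n), m = n + 1 -> is_cycle x -> i n x = 0 ->
  exists y : tensor K B m, i m y = 0 /\ cdiff (tensor K B) m n y = x.
Proof.
move=> /acyclic_exact Tex n m x mE xc ix.
have [p q|t tE] := @total_lift _ (torsion_bicomplex A B) (tensor_bicomplex K B) psi n x.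
  apply: psi_surj; rewrite -[LHS]/(sincl (totm _ n) (i n x) (p, q)) ix.
  by rewrite linear0.
have PsiE : Psi n t = x by apply: total_ext.
have [|s sE] := Tex n m t mE.
  move=> k; apply: total_ext => p q; rewrite linear0; apply: psi_inj.
  rewrite -[LHS]/(sincl (totm _ k) (Psi k (cdiff (torsion A B) n k t)) (p, q)).
  by rewrite cmapP PsiE xc linear0.
exists (Psi m s); rewrite -cmapP sE PsiE; split=> //.
by apply: total_ext => p q; rewrite linear0; exact: psi_ker.
Qed.

End TorsionKernel.

(** * Injectivity on homology of the tensor product of resolutions *)

Section TensorQuasiIso.
Variables (A B F G : complex R) (f : chain_map F A) (g : chain_map G B).
Hypotheses (Ffree : free_complex F) (Gfree : free_complex G).
Hypotheses (fsurj : forall n y, exists x, f n x = y).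
Hypotheses (gsurj : forall n y, exists x, g n x = y).
Hypotheses (fqi : quasi_iso f) (gqi : quasi_iso g).

(** Uniqueness of beta needs only that boundaries can be pulled back. This is done one factor at a
    time through F (x) B, the acyclicity hypothesis entering only for the first factor. *)
Lemma tensor_bounds : acyclic (torsion A B) ->
  forall n m (x : tensor F G n) (y : tensor A B m), m = n + 1 -> is_cycle x ->
    cdiff (tensor A B) m n y = tensor_map f g n x ->
  exists x', cdiff (tensor F G) m n x' = x.
Proof.
move=> AB_acyclic n m x y mE xc yx.
have id_surj (C : complex R) k y' : exists x', chain_id C k x' = y' by exists y'.
pose fB := tensor_map f (chain_id B); pose Fg := tensor_map (chain_id F) g.
have fgE : tensor_map f g n x = fB n (Fg n x).
  apply: total_ext => p q.
  by rewrite [RHS](tmap_comp (f2 := f p) (g2 := g q)).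
have [y' y'E] : exists y', cdiff (tensor F B) m n y' = Fg n x.
  apply: (@exact_chase _ _ _ _ (tensor_map (kerc_incl f) (chain_id B)) fB
    _ _ _ _ n m _ y) => //.
  - exact: tensor_map_surj.
  - move=> k z z0.
    have [p q|w wE] := @total_lift _ _ _
      (tensor_map_comp (kerc_incl f) (chain_id B)) k z.
      apply: (tmap_exactl (f := f p)) => // [v|]; first exact: kerc_inclP.
      by rewrite -[LHS]/(sincl (totm _ k) (fB k z) (p, q)) z0 linear0.
    by exists w; apply: total_ext.
  - by apply: tensor_exactl; [move=> k; exact: submodule_free | exact: kerc_exact].
  - exact: tensor_kernel_exact.
  - by move=> k; rewrite -cmapP xc linear0.
  - by rewrite yx.
apply: (@exact_chase _ _ _ _ (tensor_map (chain_id F) (kerc_incl g)) Fg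
  _ _ _ _ n m x y') => //.
- exact: tensor_map_surj.
- move=> k z z0.
  have [p q|w wE] := @total_lift _ _ _
    (tensor_map_comp (chain_id F) (kerc_incl g)) k z.
    apply: (tmap_exactr (g := g q)) => // [v|]; first exact: kerc_inclP.
    by rewrite -[LHS]/(sincl (totm _ k) (Fg k z) (p, q)) z0 linear0.
  by exists w; apply: total_ext.
- by apply: tensor_exactr; [move=> k; exact: submodule_free | exact: kerc_exact].
(* Here F_p is free, hence flat, so the kernel to be examined is zero. *)
move=> k l z lE zc z0; exists 0; rewrite !linear0; split=> //.
apply/esym/total_ext => p q; rewrite linear0.
apply: (free_flat (Ffree p) (@sincl_inj _ _ (kerm (g q)))).
rewrite linear0 -[LHS]/(sincl (totm _ k)
  (tensor_map (chain_id F) (kerc_incl g) k z) (p, q)).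
by rewrite z0 linear0.
Qed.

End TensorQuasiIso.
End TensorExact.

(** * Free resolutions of complexes *)

Section Cast.
Variable R : comNzRingType.
Implicit Type X : int -> lmodType R.

(* The transport X m -> X n along m = n, and 0 if m <> n. *)
Definition castm X m n : {linear X m -> X n} :=
  match m =P n with
  | ReflectT mn => match mn in _ = k return {linear X m -> X k} with
                   | erefl => lin_id (X m) end
  | ReflectF _ => \0
  end.

Lemma castm_id X m x : castm X m m x = x.
Proof. by rewrite /castm; case: eqP => // mm; rewrite (eq_irrelevance mm erefl). Qed.

Lemma castm_neq X m n x : m != n -> castm X m n x = 0.
Proof. by rewrite /castm; case: eqP. Qed.

Lemma castm_trans X m n k x : m = n -> castm X n k (castm X m n x) = castm X m k x.
Proof. by move=> mn; subst n; rewrite castm_id. Qed.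

Lemma cdiff_castm (C : complex R) m n k x :
  m = n -> cdiff C n k (castm C m n x) = cdiff C m k x.
Proof. by move=> mn; subst n; rewrite castm_id. Qed.

Lemma castm_nat X (Y : int -> lmodType R) (s : int -> int)
    (g : forall n, {linear X n -> Y (s n)}) m n x :
  m = n -> g n (castm X m n x) = castm Y (s m) (s n) (g m x).
Proof. by move=> mn; subst n; rewrite !castm_id. Qed.

End Cast.

Section Pairs.
Variables (R : comNzRingType) (U V W : lmodType R).
Fact lin_fst_subproof : linear (fst : (V * W)%type -> V).
Proof. by []. Qed.
Definition lin_fst : {linear (V * W)%type -> V} := mk_linear lin_fst_subproof.
Fact lin_snd_subproof : linear (snd : (V * W)%type -> W).
Proof. by []. Qed.
Definition lin_snd : {linear (V * W)%type -> W} := mk_linear lin_snd_subproof.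
Variables (f : {linear U -> V}) (g : {linear U -> W}).
Fact lin_pair_subproof : linear (fun x => (f x, g x) : (V * W)%type).
Proof. by move=> a x y; rewrite !linearP. Qed.
Definition lin_pair : {linear U -> (V * W)%type} := mk_linear lin_pair_subproof.
End Pairs.

(** * The free complex of a weak splitting *)

Section SplittingComplex.
Variables (R : comNzRingType) (A : complex R) (g : weak_splitting A).

Definition ws_obj (n : int) : lmodType R := (wsZ g n * wsB g (n - 1))%type.

Definition ws_diff n m : {linear ws_obj n -> ws_obj m} :=
  lin_pair (sincl _ \o (castm (wsB g) (n - 1) m \o lin_snd _ _)) \0.

Lemma ws_diffE n m x : ws_diff n m x = (sincl _ (castm (wsB g) (n - 1) m x.2), 0).
Proof. by []. Qed.

Fact ws_diff_shape n m : n != m + 1 -> ws_diff n m =1 (fun=> 0).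
Proof. by move=> nm x; rewrite ws_diffE castm_neq ?linear0 //; lia. Qed.

Fact ws_diffK n m k x : ws_diff m k (ws_diff n m x) = 0.
Proof. by rewrite ws_diffE linear0 linear0. Qed.

Definition ws_complex : complex R := Complex ws_diff_shape ws_diffK.

Definition ws_map_deg n : {linear ws_complex n -> A n} :=
  (sincl _ \o (ws_gamma g n \o lin_fst _ _)) \+
  (castm A (n - 1 + 1) n \o (ws_theta g (n - 1) \o lin_snd _ _)).

Lemma ws_mapE n x : ws_map_deg n x =
  sincl _ (ws_gamma g n x.1) + castm A (n - 1 + 1) n (ws_theta g (n - 1) x.2).
Proof. by []. Qed.

Fact ws_map_subproof n m x :
  ws_map_deg m (cdiff ws_complex n m x) = cdiff A n m (ws_map_deg n x).
Proof.
rewrite !ws_mapE !linear0 addr0 linearD cycleP add0r.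
rewrite cdiff_castm ?subrK // -[_.1]/(sincl _ (castm (wsB g) (n - 1) m x.2)).
case: (eqVneq (n - 1) m) => [<-|nm]; first by rewrite castm_id ws_thetaP.
by rewrite castm_neq // !linear0 cdiff_shape //; lia.
Qed.
Definition ws_map : chain_map ws_complex A := ChainMap ws_map_subproof.

Definition ws_inl n : {linear wsZ g n -> ws_complex n} :=
  lin_pair (lin_id _) \0.

Definition ws_inr n : {linear wsB g n -> ws_complex (n + 1)} :=
  lin_pair \0 (castm (wsB g) n (n + 1 - 1)).

Lemma ws_diff_inl n m z : cdiff ws_complex n m (ws_inl n z) = 0.
Proof. by rewrite -[LHS]/(sincl _ (castm (wsB g) (n - 1) m 0), 0) !linear0. Qed.

Lemma ws_diff_inr n w :
  cdiff ws_complex (n + 1) n (ws_inr n w) = ws_inl n (sincl _ w).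
Proof.
rewrite -[LHS]/(sincl _ (castm (wsB g) (n + 1 - 1) n (castm _ _ _ w)), 0).
by rewrite castm_trans ?addrK // castm_id.
Qed.

Lemma ws_map_inl n z : ws_map n (ws_inl n z) = sincl _ (ws_gamma g n z).
Proof. by rewrite [LHS]ws_mapE !linear0 addr0. Qed.

Lemma ws_map_inr n w : ws_map (n + 1) (ws_inr n w) = ws_theta g n w.
Proof.
rewrite [LHS]ws_mapE !linear0 add0r -[_.2]/(castm (wsB g) n (n + 1 - 1) w).
rewrite (castm_nat (s := fun n => n + 1) (ws_theta g)) ?addrK //.
by rewrite castm_trans ?addrK // castm_id.
Qed.

Lemma ws_complex_free : free_complex ws_complex.
Proof. by move=> n; apply: free_module_prod; [exact: wsZ_free | exact: wsB_free]. Qed.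

(** The differential is injective on the summand of relations, so cycles have no component there. *)
Lemma ws_cycle n (x : ws_complex n) :
  cdiff ws_complex n (n - 1) x = 0 -> x = ws_inl n x.1.
Proof.
rewrite [LHS]ws_diffE castm_id => /(congr1 fst) x0.
rewrite [LHS]surjective_pairing; congr pair; apply: sincl_inj.
by rewrite [LHS]x0 linear0.
Qed.

(** The cycles are Z_n and the boundaries are B_n, so the homology is the quotient of Z_n that
    [ws_aug] identifies with the homology of [A]. *)
Lemma ws_map_quasi_iso : quasi_iso ws_map.
Proof.
move=> n; apply: inj_surj_bijective => [|h].
  apply: linear0_inj => h; have [z <-] := qpi_surj h.
  rewrite -[qpi _ z]/(hclass _ n z) hmapE => /hclass_eq0[y yz].
  have zE : sincl _ z = ws_inl n (sincl _ z).1 by apply: ws_cycle; exact: cycleP.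
  have zB : (sincl _ z).1 \in smem (kerm (ws_aug g n)).
    apply/kermP; rewrite -ws_gammaP; apply/hclass_eq0; exists y.
    by rewrite yz -ws_map_inl -zE.
  have [w wz] := sincl_surj zB.
  by apply/hclass_eq0; exists (ws_inr n w); rewrite ws_diff_inr wz -zE.
have [z <-] := ws_aug_surj g h.
have [c cz] := @cycle_of _ ws_complex n (ws_inl n z) (ws_diff_inl _ _).
exists (hclass _ n c); rewrite hmapE -ws_gammaP; congr (hclass _ _ _).
by apply: sincl_inj; rewrite -ws_map_inl -cz.
Qed.

(** The differential of [y] is a boundary, hence the image under gamma of a relation [w]; then [y]
    minus theta of [w] is a cycle, which gamma reaches. *)
Lemma ws_map_surj : (forall n z, exists x, ws_gamma g n x = z) ->
  forall n y, exists x, ws_map n x = y.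
Proof.
move=> gs n y.
have [|c cy] := @cycle_of _ A (n - 1) (cdiff A n (n - 1) y); first exact: cdiffK.
have [z zc] := gs _ c.
have zB : z \in smem (kerm (ws_aug g (n - 1))).
  apply/kermP; rewrite -ws_gammaP zc; apply/hclass_eq0.
  exists (castm A n (n - 1 + 1) y); rewrite cdiff_castm ?subrK //.
have [w wz] := sincl_surj zB; pose x : ws_complex n := (0, w).
have [|c' c'E] := @cycle_of _ A n (y - ws_map n x).
  rewrite linearB -cmapP -[cdiff ws_complex _ _ x]/(ws_inl _ (sincl _ (castm _ _ _ x.2))).
  by rewrite castm_id ws_map_inl wz zc cy subrr.
have [z' z'E] := gs _ c'.
exists (ws_inl n z' + x); rewrite linearD ws_map_inl z'E c'E subrK //.
Qed.

End SplittingComplex.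

Section Resolutions.
Variables (R : idomainType) (R_pid : principal_ideal_ring R).

Lemma exists_surjective_resolution (A : complex R) :
  exists (F : complex R) (f : chain_map F A),
  [/\ free_complex F, quasi_iso f & forall n y, exists x, f n x = y].
Proof.
(* Free on cycles rather than on homology classes, so that gamma is onto the cycles. *)
pose Z n := freem R (cycles A n).
pose aug n : {linear Z n -> homology A n} := hclass A n \o std_aug (cycles A n).
have gs n z : exists x, std_aug (cycles A n) x = z.
  by exists (fgen R z); rewrite fliftE.
have aug_surj n h : exists z, aug n z = h.
  have [z <-] := qpi_surj h; have [x <-] := gs n z; by exists x.
have Bfree n : free_module (subm (kerm (aug n))).
  exact/submodule_free/freem_free.
have theta n : exists t : {linear subm (kerm (aug n)) -> A (n + 1)}, forall w,
    cdiff A (n + 1) n (t w) = sincl _ (std_aug (cycles A n) (sincl _ w)).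
  pose s : {linear subm (kerm (aug n)) -> A n} :=
    sincl _ \o (std_aug (cycles A n) \o sincl _).
  apply: (@free_lift _ _ _ _ _ s) => // w; apply/hclass_eq0.
  by have /kermP := sincl_in w.
pose g := @WeakSplitting R A Z aug aug_surj (fun n => @freem_free R (cycles A n))
  Bfree (fun n => std_aug (cycles A n)) (fun n => sval (cid (theta n)))
  (fun n z => erefl) (fun n => svalP (cid (theta n))).
exists (ws_complex g), (ws_map g); split.
- exact: ws_complex_free.
- exact: ws_map_quasi_iso.
- exact: ws_map_surj.
Qed.

Section Lift.
Variables (A F E : complex R) (f : chain_map F A) (e : chain_map E A).
Hypotheses (Ffree : free_complex F) (eqi : quasi_iso e).
Hypothesis esurj : forall n y, exists x, e n x = y.

(** Each F_n is the sum of its cycles and of a lifted copy of the boundaries below. The lift is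
    chosen on cycles in all degrees ([phi]), then on the complements with prescribed differential
    ([chi]); no recursion on the degree occurs. *)
Lemma chain_map_lift : exists h : chain_map F E, forall n x, e n (h n x) = f n x.
Proof.
(* Surjectivity on homology gives a lift up to a boundary, and surjectivity of [e] lifts that
   boundary. *)
have cyc_surj n (y : A n) : is_cycle y -> exists x, is_cycle x /\ e n x = y.
  move=> yc; have [x [a [xc xE]]] := quasi_iso_cycle eqi (erefl (n + 1)) yc.
  have [a' a'E] := esurj a; exists (x - cdiff E (n + 1) n a'); split.
    by move=> k; rewrite linearB xc cdiffK subr0.
  by rewrite linearB cmapP a'E xE addrK.
have phi_ex n : exists p : {linear cycles F n -> E n}, forall z,
    is_cycle (p z) /\ e n (p z) = f n (sincl _ z).
  apply: (free_lift_rel (S := fun z y => is_cycle y /\ e n y = f n (sincl _ z))).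
  - exact: submodule_free.
  - by split=> [k|]; rewrite !linear0.
  - move=> a z y z' y' [yc yE] [yc' yE']; split=> [k|].
      by rewrite linearP yc yc' scaler0 addr0.
    by rewrite !linearP yE yE'.
  - by move=> z; apply: cyc_surj => k; rewrite -cmapP cycleP linear0.
pose phi n := sval (cid (phi_ex n)).
have phiP n z : is_cycle (phi n z) /\ e n (phi n z) = f n (sincl _ z) :=
  svalP (cid (phi_ex n)) z.
have bdP n m (x : F n) : cdiff F n m x \in smem (cyc F m).
  by apply/kermP; exact: cdiffK.
pose bd n m : {linear F n -> cycles F m} := corestr (@bdP n m).
have imP n (x : F n) : bd n (n - 1) x \in smem (imm (bd n (n - 1))).
  by apply/asboolP; exists x.
pose bdi n : {linear F n -> subm (imm (bd n (n - 1)))} := corestr (@imP n).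
have im_free n : free_module (subm (imm (bd n (n - 1)))).
  by do 2!apply: submodule_free => //.
have sec n : exists s : {linear subm (imm (bd n (n - 1))) -> F n},
    forall b, bd n (n - 1) (s b) = sincl _ b.
  apply: free_lift => // b; exact/asboolP/(sincl_in b).
pose s n := sval (cid (sec n)).
have sE n b : bd n (n - 1) (s n b) = sincl _ b := svalP (cid (sec n)) b.
have chi_ex n : exists c : {linear subm (imm (bd n (n - 1))) -> E n}, forall b,
    cdiff E n (n - 1) (c b) = phi (n - 1) (sincl _ b) /\ e n (c b) = f n (s n b).
  apply: (free_lift_rel (S := fun b y =>
    cdiff E n (n - 1) y = phi (n - 1) (sincl _ b) /\ e n y = f n (s n b))) => //.
  - by rewrite !linear0.
  - by move=> a b y b' y' [y1 y2] [y1' y2']; rewrite !linearP y1 y2 y1' y2'.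
  - move=> b; have [pc pE] := phiP (n - 1) (sincl _ b).
    have dfs : cdiff A n (n - 1) (f n (s n b)) = e (n - 1) (phi (n - 1) (sincl _ b)).
      by rewrite pE -sE corestrE -cmapP.
    have [|y0 y0E] := quasi_iso_bounds eqi _ pc dfs; first by rewrite subrK.
    (* [y0] has the right differential but lies over the wrong chain; the error is a cycle and is
       removed by a cycle above it. *)
    have [|c [cc cE]] := cyc_surj n (e n y0 - f n (s n b)).
      move=> k; rewrite linearB -cmapP; case: (eqVneq k (n - 1)) => [->|kn].
        by rewrite y0E dfs subrr.
      have nk : n != k + 1 by lia.
      rewrite [cdiff E n k _]cdiff_shape // [cdiff A n k _]cdiff_shape //.
      by rewrite linear0 subr0.
    exists (y0 - c); rewrite !linearB cc subr0 cE; split=> //.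
    by rewrite opprB addrC subrK.
pose chi n := sval (cid (chi_ex n)).
have chiP n b : cdiff E n (n - 1) (chi n b) = phi (n - 1) (sincl _ b) /\
  e n (chi n b) = f n (s n b) := svalP (cid (chi_ex n)) b.
have retP n x : x - s n (bdi n x) \in smem (cyc F n).
  apply/kermP; rewrite linearB; apply/eqP; rewrite subr_eq0 eq_sym; apply/eqP.
  exact: (congr1 (sincl _) (sE n (bdi n x))).
have ret_lin n : linear (fun x => x - s n (bdi n x)).
  by move=> a x y; rewrite !linearP addrACA -scalerDr.
pose ret n : {linear F n -> cycles F n} :=
  @corestr R (F n) (cyc F n) _ (mk_linear (ret_lin n)) (retP n).
have h_lin n : linear (fun x => phi n (ret n x) + chi n (bdi n x)).
  by move=> a x y; rewrite !linearP scalerDr addrACA.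
have hP n m x : mk_linear (h_lin m) (cdiff F n m x) =
    cdiff E n m (mk_linear (h_lin n) x).
  rewrite -[LHS]/(phi m (ret m (cdiff F n m x)) + chi m (bdi m (cdiff F n m x))).
  rewrite -[X in _ = cdiff _ _ _ X]/(phi n (ret n x) + chi n (bdi n x)).
  rewrite linearD (phiP n _).1 add0r.
  have -> : bdi m (cdiff F n m x) = 0.
    by do 2!apply: sincl_inj; rewrite !corestrE !linear0; exact: cdiffK.
  rewrite linear0 addr0; case: (eqVneq m (n - 1)) => [mE|mn]; last first.
    have nm : n != m + 1 by lia.
    by rewrite [RHS]cdiff_shape // [cdiff F n m x]cdiff_shape // !linear0.
  subst m; rewrite (chiP n _).1; congr (phi _ _).
  apply: sincl_inj; rewrite !corestrE.
  rewrite -[LHS]/(cdiff F n (n - 1) x - s (n - 1) (bdi (n - 1) (cdiff F n (n - 1) x))).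
  have -> : bdi (n - 1) (cdiff F n (n - 1) x) = 0.
    by do 2!apply: sincl_inj; rewrite !corestrE !linear0; exact: cdiffK.
  by rewrite linear0 subr0.
exists (@ChainMap R F E (fun n => mk_linear (h_lin n)) hP) => n x.
rewrite -[h in e n h]/(phi n (ret n x) + chi n (bdi n x)) linearD.
by rewrite (phiP n _).2 (chiP n _).2 -linearD subrK.
Qed.

End Lift.
End Resolutions.

(** * Uniqueness in the Kuenneth formula *)

Section KuennethNaturality.
Variable R : comNzRingType.

Lemma bnd_map (C D : complex R) (f : chain_map C D) n z :
  z \in smem (bnd C n) -> cyc_map f n z \in smem (bnd D n).
Proof.
move=> /asboolP[y yz]; apply/asboolP; exists (f (n + 1) y).
by rewrite -cmapP yz.
Qed.

Lemma tor_resE (F F' : lmodType R) (S : submodule F) (S' : submodule F')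
    (phi : {linear F -> F'}) (phiS : forall x, x \in smem S -> phi x \in smem S')
    (N N' : lmodType R) (g : {linear N -> N'}) t :
  sincl _ (tor_res_map phiS g t) = tmap (restr phiS) g (sincl _ t).
Proof. by []. Qed.

Lemma tor_res_ker (F : lmodType R) (S : submodule F) (N : lmodType R)
    (t : tor_res S N) : tmap (sincl S) (lin_id N) (sincl _ t) = 0.
Proof. by have /kermP := sincl_in t. Qed.

Lemma kuenneth_free_natural (F G F' G' : complex R) (h : chain_map F F')
    (k : chain_map G G') n p q c u :
  @kuenneth_free_rel R F G n p q c u ->
  @kuenneth_free_rel R F' G' n p q (cyc_map (tensor_map h k) n c)
    (tor_res_map (@bnd_map _ _ h p) (hmap k q) u).
Proof.
move=> [w [w1 w2]]; exists (tmap (restr (@bnd_map _ _ h p)) (cyc_map k q) w); split.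
  rewrite (tmap_comp (f2 := restr (@bnd_map _ _ h p))
    (g2 := k q \o sincl (cyc G q))) //.
  rewrite -(@tmap_comp _ _ _ _ _ _ _ (lin_id _) (sincl (cyc G q))
    (restr (@bnd_map _ _ h p)) (k q)) // w1.
  rewrite -[tot_comp _ _ (sincl _ (cyc_map _ _ _))]/(tmap (h (p + 1)) (k q)
    (tot_comp (p + 1) q (sincl _ c))).
  rewrite (tmap_comp (f2 := bdiff F' p \o h (p + 1)) (g2 := k q)) //.
  rewrite (tmap_comp (f2 := bdiff F' p \o h (p + 1)) (g2 := k q)) // => x.
  by do 2!apply: sincl_inj; exact: cmapP.
rewrite tor_resE w2.
rewrite (tmap_comp (f2 := restr (@bnd_map _ _ h p)) (g2 := hmap k q \o hclass G q)) //.
rewrite (tmap_comp (f2 := restr (@bnd_map _ _ h p)) (g2 := hmap k q \o hclass G q)) //.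
by move=> z; exact/esym/hmapE.
Qed.

Lemma tot_compB (D : bicomplex R) n p q (x y : Defs.total D n) :
  tot_comp p q (x - y) = tot_comp p q x - tot_comp p q y.
Proof. by rewrite /tot_comp linearB. Qed.

Lemma kuenneth_freeB (F G : complex R) n p q c c' u u' :
  @kuenneth_free_rel R F G n p q c u -> @kuenneth_free_rel R F G n p q c' u' ->
  kuenneth_free_rel (c - c') (u - u').
Proof.
move=> [w [w1 w2]] [w' [w1' w2']]; exists (w - w'); split.
  have -> : tot_comp (p + 1) q (sincl (cyc (tensor F G) n) (c - c')) =
      tot_comp (p + 1) q (sincl _ c) - tot_comp (p + 1) q (sincl _ c').
    by rewrite linearB; exact: tot_compB.
  by rewrite [LHS]linearB w1 w1' [RHS]linearB.
by rewrite !linearB w2 w2'.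
Qed.

(** Lifts to resolutions matter only modulo relations; this frees the value of beta from the choice
    of [phi] in [kuenneth_rel]. *)
Lemma tor_res_map_factor (F0 F1 F2 : lmodType R) (S0 : submodule F0)
    (S1 : submodule F1) (S2 : submodule F2) (N0 N1 N2 : lmodType R)
    (h : {linear F0 -> F1}) (hS : forall x, x \in smem S0 -> h x \in smem S1)
    (phi : {linear F1 -> F2}) (phiS : forall x, x \in smem S1 -> phi x \in smem S2)
    (psi : {linear F0 -> F2}) (psiS : forall x, x \in smem S0 -> psi x \in smem S2)
    (k : {linear N0 -> N1}) (g : {linear N1 -> N2}) (e : {linear N0 -> N2}) t :
  (forall x, phi (h x) - psi x \in smem S2) -> g \o k =1 e ->
  tor_res_map phiS g (tor_res_map hS k t) = tor_res_map psiS e t.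
Proof.
move=> diffS gk; have phihS x : x \in smem S0 -> (phi \o h) x \in smem S2.
  by move=> /hS/phiS.
apply: sincl_inj; rewrite !tor_resE (tmap_comp (f2 := restr phihS) (g2 := e)) //.
  by apply: tmap_restr_indep => //; exact: tor_res_ker.
exact: restr_comp.
Qed.

End KuennethNaturality.

Section KuennethUniqueness.
Variables (R : idomainType) (R_pid : principal_ideal_ring R).

(** Under d (x) 1 the horizontal part of the boundary of [e] dies and the vertical part becomes d
    (x) d of one component. Thus [w] has second factors in the boundaries of [G], which vanish in
    homology. *)
Lemma kuenneth_free_boundary (F G : complex R) n p q c u
    (e : tensor F G (n + 1)) : free_complex F ->
  cdiff (tensor F G) (n + 1) n e = sincl _ c ->
  @kuenneth_free_rel R F G n p q c u -> u = 0.
Proof.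
move=> Ffree ec [w [w1 w2]]; apply: sincl_inj; rewrite w2 linear0.
pose b := sgn R (p + 1) *: tot_comp (p + 1) (q + 1) e.
have -> : w = tmap (bdiff F p) (sincl (bnd G q) \o bdiff G q) b.
  (* Flatness of the boundaries makes [w] determined by its image in B_p (x) G_q. *)
  have Bfree : free_module (boundaries F p) by do 2!apply: submodule_free => //.
  apply: (free_flat Bfree (@sincl_inj _ _ (cyc G q))); rewrite w1 -ec.
  rewrite [tot_comp _ _ _](total_diffE' e) // linearD.
  rewrite [X in X + _](tmap_comp (f2 := \0) (g2 := lin_id (G q))) //; last first.
    by move=> x; do 2!apply: sincl_inj; rewrite !linear0; exact: cdiffK.
  rewrite [X in X + _]tmap_eq0 ?add0r; last by left.
  rewrite !linearZZ; congr (_ *: _).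
  rewrite (tmap_comp (f2 := bdiff F p) (g2 := cdiff G (q + 1) q)) //.
  by rewrite (tmap_comp (f2 := bdiff F p) (g2 := cdiff G (q + 1) q)).
rewrite (tmap_comp (f2 := bdiff F p) (g2 := \0)) //.
  by apply: tmap_eq0; right.
by move=> x; apply/hclass_eq0; exists x.
Qed.

Variables (A B : complex R) (AB_acyclic : acyclic (torsion A B)).

Lemma kuenneth_rel_unique n k l x t t' :
  @kuenneth_rel R A B n k l x t -> kuenneth_rel x t' -> t = t'.
Proof.
have [F0 [f0 [F0free f0qi f0surj]]] := exists_surjective_resolution R_pid A.
have [G0 [g0 [G0free g0qi g0surj]]] := exists_surjective_resolution R_pid B.
have [phi0 phi0E] : exists phi0 : {linear cycles F0 k -> freem R (homology A k)},
    forall z, std_aug _ (phi0 z) = hmap f0 k (hclass F0 k z).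
  apply: (@free_lift _ _ _ _ _ (hmap f0 k \o hclass F0 k)).
    exact: submodule_free.
  by move=> z; exists (fgen R (hmap f0 k (hclass F0 k z))); rewrite fliftE.
have phi0S z : z \in smem (bnd F0 k) -> phi0 z \in smem (std_rel (homology A k)).
  by move=> zB; apply/kermP; rewrite phi0E (iffRL (qpi_eq0 _ z) zB) linear0.
(* Every computation of beta is pushed to one fixed pair of surjective resolutions and one fixed
   [phi0], where two of them can be subtracted. *)
have factor y s : kuenneth_rel y s -> exists (c : cycles (tensor F0 G0) n)
    (u : tor_res (bnd F0 k) (homology G0 l)),
    [/\ hmap (tensor_map f0 g0) n (hclass _ n c) = y, kuenneth_free_rel c u &
        s = tor_res_map phi0S (hmap g0 l) u].
  move=> [F [G [f [g [[Ffree Gfree fqi gqi] [c [u [phi [phiS [cy cu phiE sE]]]]]]]]]].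
  have [h hE] := chain_map_lift R_pid f Ffree f0qi f0surj.
  have [m mE] := chain_map_lift R_pid g Gfree g0qi g0surj.
  exists (cyc_map (tensor_map h m) n c), (tor_res_map (@bnd_map _ _ _ h k) (hmap m l) u).
  split.
  - rewrite -cy !hmapE; congr (hclass _ _ _); apply/sincl_inj/total_ext => p q.
    exact: (tmap_comp (hE p) (mE q)).
  - exact: kuenneth_free_natural.
  rewrite sE; apply/esym/tor_res_map_factor => z.
    apply/kermP; rewrite linearB phi0E phiE !hmapE -linearB.
    suff -> : cyc_map f0 k (cyc_map h k z) = cyc_map f k z by rewrite subrr linear0.
    by apply: sincl_inj; exact: hE.
  have [z' <-] := qpi_surj z; rewrite -[qpi _ z']/(hclass _ _ z') [LHS]/comp !hmapE.
  by congr (hclass _ _ _); apply: sincl_inj; exact: mE.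
move=> /factor[c [u [cx cu ->]]] /factor[c' [u' [cx' cu' ->]]].
suff -> : u = u' by [].
have : hmap (tensor_map f0 g0) n (hclass _ n (c - c')) = 0.
  by rewrite !linearB cx cx' subrr.
move=> /hmap_eq0[y yE].
have [e eE] := tensor_bounds R_pid F0free G0free f0surj g0surj f0qi g0qi
  AB_acyclic (erefl (n + 1)) (cycle_is_cycle (c - c')) yE.
apply/subr0_eq/(kuenneth_free_boundary F0free eE); exact: kuenneth_freeB.
Qed.

End KuennethUniqueness.

(** * The splitting map *)

Section TotalInclusion.
Variable R : comNzRingType.

Lemma total_diff_in (D : bicomplex R) i j (x : D (i + 1) (j + 1)) :
  cdiff (Defs.total D) (i + j + 1 + 1) (i + j + 1)
    (tot_in D (i + j + 1 + 1) (i + 1) (j + 1) x) =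
  tot_in D (i + j + 1) i (j + 1) (bhor D (i + 1) i (j + 1) x) +
  sgn R (i + 1) *: tot_in D (i + j + 1) (i + 1) j (bver D (i + 1) (j + 1) j x).
Proof.
apply: total_ext => p q; rewrite total_diffE' // linearD linearZ.
rewrite -[RHS]/(sincl (totm D _) _ (p, q) +
  sgn R (i + 1) *: sincl (totm D _) _ (p, q)); congr (_ + _).
  case: (eqVneq (i + 1, j + 1) (p + 1, q)) => [[/addIr ip jq]|ne].
    by subst p q; rewrite !tot_in_same //; lia.
  rewrite !tot_in_diff ?linear0 //.
  by apply: contra ne => /eqP[-> ->].
case: (eqVneq (i + 1, j + 1) (p, q + 1)) => [[ip /addIr jq]|ne].
  by subst p q; rewrite !tot_in_same //; lia.
rewrite !tot_in_diff ?linear0 ?scaler0 //.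
by apply: contra ne => /eqP[-> ->].
Qed.

Lemma tot_map_in (D E : bicomplex R) (f : forall p q, {linear D p q -> E p q})
    (fhor : forall p p' q x, f p' q (bhor D p p' q x) = bhor E p p' q (f p q x))
    (fver : forall p q q' x, f p q' (bver D p q q' x) = bver E p q q' (f p q x))
    n i j (x : D i j) :
  i + j = n -> tot_map fhor fver n (tot_in D n i j x) = tot_in E n i j (f i j x).
Proof.
move=> ijn; apply: total_ext => p q.
rewrite -[LHS]/(f p q (sincl (totm D n) (tot_in D n i j x) (p, q))).
case: (eqVneq (i, j) (p, q)) => [[ip jq]|ne]; first by subst p q; rewrite !tot_in_same.
by rewrite !tot_in_diff ?linear0.
Qed.

End TotalInclusion.

Lemma homology_lift (R : idomainType) (R_pid : principal_ideal_ring R)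
    (A F : complex R) (f : chain_map F A) k : free_complex F ->
  exists phi : {linear cycles F k -> freem R (homology A k)},
    (forall z, std_aug _ (phi z) = hmap f k (hclass F k z)) /\
    (forall z, z \in smem (bnd F k) -> phi z \in smem (std_rel (homology A k))).
Proof.
move=> Ffree; have [||phi phiE] := @free_lift _ (cycles F k) _ _
  (std_aug (homology A k)) (hmap f k \o hclass F k).
- exact: submodule_free.
- by move=> z; exists (fgen R (hmap f k (hclass F k z))); rewrite fliftE.
exists phi; split=> // z zb.
apply/kermP; rewrite [LHS]phiE -[RHS](linear0 (hmap f k)); congr (hmap _ _ _).
exact/qpi_eq0.
Qed.

Section SplittingMap.
Variables (R : idomainType) (R_pid : principal_ideal_ring R).
Variables (A B : complex R) (gA : weak_splitting A) (gB : weak_splitting B).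
Variables i j : int.

Local Notation F := (ws_complex gA).
Local Notation G := (ws_complex gB).
Local Notation FG := (tensor F G).
Local Notation D := (tensor_bicomplex F G).
Local Notation n := (i + j + 1).
Local Notation fg := (tensor_map (ws_map gA) (ws_map gB)).
Local Notation iA := (sincl (kerm (ws_aug gA i))).
Local Notation iB := (sincl (kerm (ws_aug gB j))).

Definition M_lift (w : tens (wsB gA i) (wsZ gB j)) (v : tens (wsZ gA i) (wsB gB j)) :
    FG n :=
  sgn R (i + 1) *: tot_in D n i (j + 1) (tmap (ws_inl gA i) (ws_inr gB j) v) +
  tot_in D n (i + 1) j (tmap (ws_inr gA i) (ws_inl gB j) w).

Lemma M_lift_linear a w w' v v' :
  M_lift (a *: w + w') (a *: v + v') = a *: M_lift w v + M_lift w' v'.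
Proof.
have lin (U V W : lmodType R) (f : {linear V -> W}) (h : {linear U -> W})
    (s : R) x x' y y' : s *: f (a *: y + y') + h (a *: x + x') =
    a *: (s *: f y + h x) + (s *: f y' + h x').
  by rewrite (linearD f) (linearD h) !linearZZ !scalerDr !scalerA [s * a]mulrC addrACA.
exact: (lin _ _ _ (tot_in D n i (j + 1) \o tmap (ws_inl gA i) (ws_inr gB j))
  (tot_in D n (i + 1) j \o tmap (ws_inr gA i) (ws_inl gB j))).
Qed.

Lemma M_lift_comp w v p q : tot_comp p q (M_lift w v) =
  sgn R (i + 1) *: tot_comp p q (tot_in D n i (j + 1)
    (tmap (ws_inl gA i) (ws_inr gB j) v)) +
  tot_comp p q (tot_in D n (i + 1) j (tmap (ws_inr gA i) (ws_inl gB j) w)).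
Proof. by []. Qed.

Lemma M_lift_cycle w v : tmap iA (lin_id _) w = tmap (lin_id _) iB v ->
  cdiff FG n (n - 1) (M_lift w v) = 0.
Proof.
move=> wv; rewrite /M_lift linearD linearZZ.
rewrite total_diff_inr ?total_diff_inl //; last 2 first.
- move=> q; rewrite [LHS](tmap_comp (f2 := ws_inr gA i) (g2 := \0)) //.
    by apply: tmap_eq0; right.
  by move=> z; exact: ws_diff_inl.
- move=> p; rewrite [LHS](tmap_comp (f2 := \0) (g2 := ws_inr gB j)) //.
    by apply: tmap_eq0; left.
  by move=> z; exact: ws_diff_inl.
have -> : bver D i (j + 1) j (tmap (ws_inl gA i) (ws_inr gB j) v) =
    tmap (ws_inl gA i) (ws_inl gB j) (tmap (lin_id _) iB v).
  rewrite (tmap_comp (f2 := ws_inl gA i) (g2 := ws_inl gB j \o iB)) //.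
  rewrite [LHS](tmap_comp (f2 := ws_inl gA i) (g2 := ws_inl gB j \o iB)) //.
  by move=> z; exact: ws_diff_inr.
have -> : bhor D (i + 1) i j (tmap (ws_inr gA i) (ws_inl gB j) w) =
    tmap (ws_inl gA i) (ws_inl gB j) (tmap iA (lin_id _) w).
  rewrite (tmap_comp (f2 := ws_inl gA i \o iA) (g2 := ws_inl gB j)) //.
  rewrite [LHS](tmap_comp (f2 := ws_inl gA i \o iA) (g2 := ws_inl gB j)) //.
  by move=> z; exact: ws_diff_inr.
(* The prefactor (-1)^(i+1) meets the sign (-1)^i of the vertical differential, so the two terms
   cancel. *)
by rewrite wv scalerA sgnS mulNr sgnK scaleN1r addNr.
Qed.

(** Pairs coming from B_i (x) B_j are exactly the ambiguity in choosing [w] and [v]; that they give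
    boundaries makes [mu] single-valued. *)
Lemma M_lift_boundary (q : tens (wsB gA i) (wsB gB j)) :
  cdiff FG (n + 1) n
    (sgn R (i + 1) *: tot_in D (n + 1) (i + 1) (j + 1)
      (tmap (ws_inr gA i) (ws_inr gB j) q)) =
  M_lift (tmap (lin_id _) iB q) (tmap iA (lin_id _) q).
Proof.
have hE : bhor D (i + 1) i (j + 1) (tmap (ws_inr gA i) (ws_inr gB j) q) =
    tmap (ws_inl gA i) (ws_inr gB j) (tmap iA (lin_id _) q).
  rewrite (tmap_comp (f2 := ws_inl gA i \o iA) (g2 := ws_inr gB j)) //.
  rewrite [LHS](tmap_comp (f2 := ws_inl gA i \o iA) (g2 := ws_inr gB j)) //.
  by move=> z; exact: ws_diff_inr.
have vE : bver D (i + 1) (j + 1) j (tmap (ws_inr gA i) (ws_inr gB j) q) =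
    tmap (ws_inr gA i) (ws_inl gB j) (tmap (lin_id _) iB q).
  rewrite (tmap_comp (f2 := ws_inr gA i) (g2 := ws_inl gB j \o iB)) //.
  rewrite [LHS](tmap_comp (f2 := ws_inr gA i) (g2 := ws_inl gB j \o iB)) //.
  by move=> z; exact: ws_diff_inr.
rewrite linearZZ (@total_diff_in R D i j) hE vE scalerDr scalerA.
by rewrite sgnK scale1r.
Qed.

Section Relation.
Variable phi : {linear freem R (homology A i) -> wsZ gA i}.
Hypothesis phiE : forall x, ws_aug gA i (phi x) = std_aug _ x.
Hypothesis phiS : forall x,
  x \in smem (std_rel (homology A i)) -> phi x \in smem (kerm (ws_aug gA i)).
Local Notation HB := (homology B j).

(** A relation, since [w], [v] and [c] involve choices: [phi] carries [t] from the standard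
    resolution to B_i (x) H_j, and [w] is a lift of the result to B_i (x) Z_j. *)
Definition mu_rel (t : tor (homology A i) HB) (x : homology (tensor A B) n) : Prop :=
  exists (w : tens (wsB gA i) (wsZ gB j)) (v : tens (wsZ gA i) (wsB gB j))
    (c : cycles FG n),
  [/\ tmap iA (lin_id _) w = tmap (lin_id _) iB v, sincl _ c = M_lift w v,
      tmap (lin_id _) (ws_aug gB j) w = tmap (restr phiS) (lin_id _) (sincl _ t) &
      x = hmap fg n (hclass FG n c)].

Lemma mu_rel_linear a t x t' x' :
  mu_rel t x -> mu_rel t' x' -> mu_rel (a *: t + t') (a *: x + x').
Proof.
move=> [w [v [c [wv cE wE ->]]]] [w' [v' [c' [wv' cE' wE' ->]]]].
exists (a *: w + w'), (a *: v + v'), (a *: c + c'); split.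
- by rewrite !linearP wv wv'.
- by rewrite M_lift_linear linearP cE cE'.
- by rewrite !linearP wE wE'.
by rewrite !linearP.
Qed.

(** As [t] lies in the kernel defining the torsion product, the image of [w] in Z_i (x) Z_j dies in
    Z_i (x) H_j, and right exactness provides [v]. *)
Lemma mu_rel_total t : exists x, mu_rel t x.
Proof.
have id_surj (V : lmodType R) (y : V) : exists x, lin_id V x = y by exists y.
have [w wE] := tmap_surj (id_surj _) (@ws_aug_surj _ _ gB j)
  (tmap (restr phiS) (lin_id _) (sincl _ t)).
have [|||v vE] := @tmap_exactr _ (wsZ gA i) _ _ _ iB (ws_aug gB j) _ _
  (tmap iA (lin_id _) w).
- exact: ws_aug_surj.
- by move=> z /kermP /sincl_surj.
- rewrite (tmap_comp (f2 := iA) (g2 := ws_aug gB j)) //.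
  rewrite -(@tmap_comp _ _ _ _ _ _ _ (lin_id _) (ws_aug gB j) iA (lin_id _)) // wE.
  rewrite (tmap_comp (f2 := phi \o sincl _) (g2 := lin_id _)) //.
  rewrite -(@tmap_comp _ _ _ _ _ _ _ (sincl _) (lin_id _) phi (lin_id _)) //.
  by rewrite tor_res_ker linear0.
have [c cE] := cycle_of (M_lift_cycle (esym vE)).
by exists (hmap fg n (hclass FG n c)), w, v, c; split.
Qed.

(** [w - w'] dies in B_i (x) H_j, so it comes from some [q] in B_i (x) B_j; flatness of Z_i shows
    that the same [q] accounts for [v - v']. *)
Lemma mu_rel_functional t x x' : mu_rel t x -> mu_rel t x' -> x = x'.
Proof.
move=> [w [v [c [wv cE wE ->]]]] [w' [v' [c' [wv' cE' wE' ->]]]].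
congr (hmap _ _ _); apply/eqP; rewrite -subr_eq0 -linearB; apply/eqP/hclass_eq0.
have [|||q qE] := @tmap_exactr _ (wsB gA i) _ _ _ iB (ws_aug gB j) _ _ (w - w').
- exact: ws_aug_surj.
- by move=> z /kermP /sincl_surj.
- by rewrite linearB wE wE' subrr.
have qE' : tmap iA (lin_id _) q = v - v'.
  apply: (free_flat (wsZ_free gA i) (@sincl_inj _ _ (kerm (ws_aug gB j)))).
  rewrite linearB -wv -wv' -linearB -qE.
  rewrite (tmap_comp (f2 := iA) (g2 := iB)) //.
  by rewrite (tmap_comp (f2 := iA) (g2 := iB)).
exists (sgn R (i + 1) *: tot_in D (n + 1) (i + 1) (j + 1)
  (tmap (ws_inr gA i) (ws_inr gB j) q)).
rewrite M_lift_boundary qE qE' linearB cE cE'.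
have := M_lift_linear (-1) w' w v' v.
by rewrite !scaleN1r ![- _ + _]addrC.
Qed.

Lemma mu_rel_etor (a : homology A i) (r : R) (b : homology B j)
    (ra : r *: a = 0) (rb : r *: b = 0) (ah : wsZ gA i) (bh : wsZ gB j)
    (ahP : ws_aug gA i ah = a) (bhP : ws_aug gB j bh = b) :
  mu_rel (etor ra rb) (hclass (tensor A B) n (M_cycle ra rb ahP bhP)).
Proof.
pose w := tpure (scaled_lift ra ahP) bh; pose v := tpure ah (scaled_lift rb bhP).
have wv : tmap iA (lin_id _) w = tmap (lin_id _) iB v.
  by rewrite !tmapE -[iA _]/(r *: ah) -[iB _]/(r *: bh) tpureZl tpureZr.
have [c cE] := cycle_of (M_lift_cycle wv); exists w, v, c; split=> //.
  rewrite tmapE bhP [RHS]tmapE; apply/eqP; rewrite -subr_eq0 -tpureBl; apply/eqP.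
  (* The lift [ah] and the one given by [phi] differ by a relation [k], and r k (x) b = k (x) r b =
     0. *)
  have [|k kE] := @sincl_surj _ _ (kerm (ws_aug gA i)) (ah - phi (fgen R a)).
    by apply/kermP; rewrite linearB ahP phiE fliftE subrr.
  have -> : lin_id (wsB gA i) (scaled_lift ra ahP) -
      restr phiS (exist _ (r *: fgen R a) (etor_rel ra) : subm (std_rel _)) = r *: k.
    apply: sincl_inj; rewrite linearB linearZZ kE corestrE.
    rewrite -[X in _ - X]/(phi (r *: fgen R a)) linearZZ.
    by rewrite -[X in X - _]/(r *: ah) scalerBr.
  by rewrite tpureZl -tpureZr rb tpure0r.
rewrite hmapE; congr (hclass _ _ _); apply: sincl_inj.
rewrite corestrE -[RHS]/(fg n (sincl _ c)) cE /M_lift linearD linearZZ.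
rewrite !tot_map_in; try lia.
rewrite [tmap _ _ v]tmapE [tmap _ _ w]tmapE.
rewrite [tensor_map_comp _ _ i (j + 1) _]tmapE [tensor_map_comp _ _ (i + 1) j _]tmapE.
by rewrite !ws_map_inl !ws_map_inr.
Qed.

Lemma mu_rel_kuenneth t x : mu_rel t x -> kuenneth_rel x t.
Proof.
move=> [w [v [c [wv cE wE xE]]]].
exists F, G, (ws_map gA), (ws_map gB); split.
  by split; [exact: ws_complex_free | exact: ws_complex_free |
             exact: ws_map_quasi_iso | exact: ws_map_quasi_iso].
have inlP (C : complex R) (g : weak_splitting C) k z :
    ws_inl g k z \in smem (cyc (ws_complex g) k).
  by apply/kermP; exact: ws_diff_inl.
pose zA := corestr (@inlP A gA i); pose zB := corestr (@inlP B gB j).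
pose beta := bdiff F i \o ws_inr gA i.
have zB0 b : hclass G j (zB (iB b)) = 0.
  by apply/hclass_eq0; exists (ws_inr gB j b); exact: ws_diff_inr.
have zAbeta k : sincl (bnd F i) (beta k) = zA (iA k).
  by apply: sincl_inj; exact: ws_diff_inr.
have hA z : hmap (ws_map gA) i (hclass F i (zA z)) = ws_aug gA i z.
  rewrite -ws_gammaP hmapE; congr (hclass _ _ _); apply: sincl_inj.
  exact: ws_map_inl.
have hB z : hmap (ws_map gB) j (hclass G j (zB z)) = ws_aug gB j z.
  rewrite -ws_gammaP hmapE; congr (hclass _ _ _); apply: sincl_inj.
  exact: ws_map_inl.
(* Replacing [w] by [v] moves the relation to the second factor, where it is a boundary of the
   splitting complex of [B]. *)
have uP : tmap (sincl (bnd F i)) (lin_id _)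
    (tmap (lin_id _) (hclass G j) (tmap beta zB w)) = 0.
  rewrite (tmap_comp (f2 := beta) (g2 := hclass G j \o zB)) //.
  rewrite (tmap_comp (f2 := zA \o iA) (g2 := hclass G j \o zB)) //.
  rewrite -(@tmap_comp _ _ _ _ _ _ _ iA (lin_id _) zA (hclass G j \o zB)) // wv.
  rewrite (tmap_comp (f2 := zA) (g2 := \0)) //.
  by apply: tmap_eq0; right.
have [u uE] := sincl_surj (iffRL (kermP _ _) uP).
have [phi2 [phi2E phi2S]] := homology_lift R_pid (ws_map gA) i (@ws_complex_free _ _ gA).
exists c, u, phi2, phi2S; split=> //.
  exists (tmap beta zB w); split=> //.
  rewrite (tmap_comp (f2 := beta) (g2 := ws_inl gB j)) //.
  have -> : tot_comp (i + 1) j (sincl _ c) = tmap (ws_inr gA i) (ws_inl gB j) w.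
    rewrite cE M_lift_comp /tot_comp tot_in_same; last by lia.
    rewrite tot_in_diff ?scaler0 ?add0r //.
    by apply/eqP => -[/eqP]; lia.
  by rewrite (tmap_comp (f2 := beta) (g2 := ws_inl gB j)).
apply: sincl_inj; rewrite tor_resE uE.
rewrite (tmap_comp (f2 := beta) (g2 := hclass G j \o zB)) //.
rewrite (tmap_comp (f2 := restr phi2S \o beta) (g2 := ws_aug gB j)) //.
rewrite -(@tmap_comp _ _ _ _ _ _ _ (lin_id _) (ws_aug gB j)
  (restr phi2S \o beta) (lin_id _)) // wE.
(* The round trip through the splitting complex lifts the identity of H_i(A), so it acts as the
   identity on the torsion product. *)
have lift_id y : std_aug _ ((phi2 \o (zA \o phi)) y) = std_aug _ y.
  exact: etrans (phi2E _) (etrans (hA _) (phiE _)).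
have psiS y : y \in smem (std_rel (homology A i)) ->
    (phi2 \o (zA \o phi)) y \in smem (std_rel (homology A i)).
  by move=> /kermP y0; apply/kermP; rewrite lift_id.
rewrite (tmap_comp (f2 := restr psiS) (g2 := lin_id _)) //; last first.
  move=> y; apply: sincl_inj; rewrite [RHS]corestrE.
  by rewrite -[LHS]/(phi2 (sincl (bnd F i) (beta (restr phiS y)))) zAbeta.
have idS y : y \in smem (std_rel (homology A i)) ->
  lin_id _ y \in smem (std_rel (homology A i)) by [].
rewrite (@tmap_restr_indep _ _ _ _ _ _ _ _ (lin_id _) psiS idS) => [|y|].
- rewrite -[LHS]tmap_id; apply: eq_tmap => // y; exact: sincl_inj.
- by apply/kermP; rewrite linearB lift_id subrr.
exact: tor_res_ker.
Qed.

(** Off (i, j), the component read by beta can be nonzero only at (i, j + 1). There the first factor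
    lies in Z_i, which consists of cycles, so d (x) 1 kills it and [w = 0] serves as witness. *)
Lemma mu_rel_kuenneth0 t x k l : k + l = i + j -> (k, l) != (i, j) ->
  mu_rel t x -> kuenneth_rel x (0 : tor (homology A k) (homology B l)).
Proof.
move=> kl ne [w [v [c [wv cE wE xE]]]].
exists F, G, (ws_map gA), (ws_map gB); split.
  by split; [exact: ws_complex_free | exact: ws_complex_free |
             exact: ws_map_quasi_iso | exact: ws_map_quasi_iso].
have [phi2 [phi2E phi2S]] := homology_lift R_pid (ws_map gA) k (@ws_complex_free _ _ gA).
exists c, 0, phi2, phi2S; split=> //; last by rewrite linear0.
exists 0; rewrite !linear0; split=> //; apply/esym.
rewrite cE M_lift_comp linearD linearZZ.
rewrite [tot_comp (k + 1) l (tot_in D n (i + 1) j _)]tot_in_diff; last first.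
  by apply: contra ne => /eqP[/addIr -> ->].
rewrite linear0 addr0.
have tmap_inl p q (X : lmodType R) (h : {linear F p -> X}) :
    (forall z, is_cycle z -> h z = 0) ->
    tmap h (lin_id (G q)) (tot_comp p q (tot_in D n i (j + 1)
      (tmap (ws_inl gA i) (ws_inr gB j) v))) = 0.
  move=> h0; case: (eqVneq (i, j + 1) (p, q)) => [[ip jq]|pq]; last first.
    by rewrite [tot_comp _ _ _]tot_in_diff // linear0.
  subst p q; rewrite [tot_comp _ _ _]tot_in_same; last by lia.
  rewrite (tmap_comp (f2 := \0) (g2 := ws_inr gB j)) //.
    by apply: tmap_eq0; left.
  by move=> z; apply: h0 => m; exact: ws_diff_inl.
rewrite tmap_inl ?scaler0 // => z zc.
by do 2!apply: sincl_inj; rewrite !linear0; exact: zc.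
Qed.


End Relation.

End SplittingMap.

Theorem theorem4p3 (R : idomainType) (R_pid : principal_ideal_ring R)
    (A B : complex R) (AB_acyclic : acyclic (torsion A B))
    (gA : weak_splitting A) (gB : weak_splitting B) (i j : int) :
  exists mu : {linear tor (homology A i) (homology B j) ->
                      homology (tensor A B) (i + j + 1)},
    (forall (a : homology A i) (r : R) (b : homology B j)
       (ra : r *: a = 0) (rb : r *: b = 0)
       (ah : wsZ gA i) (bh : wsZ gB j)
       (ahP : ws_aug gA i ah = a) (bhP : ws_aug gB j bh = b),
       mu (etor ra rb) =
         hclass (tensor A B) (i + j + 1) (M_cycle ra rb ahP bhP)) /\
    splits_kuenneth mu.
Proof.
have [phi phiE] : exists phi : {linear freem R (homology A i) -> wsZ gA i},
    forall x, ws_aug gA i (phi x) = std_aug _ x.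
  by apply: free_lift; [exact: freem_free | move=> m; exact: ws_aug_surj].
have phiS x : x \in smem (std_rel (homology A i)) ->
    phi x \in smem (kerm (ws_aug gA i)).
  by move=> /kermP x0; apply/kermP; rewrite phiE.
have [|t|t x x'|mu muP] := linear_of_rel (S := mu_rel gB (j := j) phiS).
- exact: mu_rel_linear.
- exact: mu_rel_total.
- exact: mu_rel_functional.
exists mu; split=> [a r b ra rb ah bh ahP bhP|].
  by apply: mu_rel_functional (muP _) _; exact: mu_rel_etor.
split=> [t|k l kl ne t]; split=> [|u xu].
- exact: mu_rel_kuenneth (muP t).
- by apply: (kuenneth_rel_unique R_pid AB_acyclic) xu _; exact: mu_rel_kuenneth (muP t).
- exact: mu_rel_kuenneth0 (muP t).
- by apply: (kuenneth_rel_unique R_pid AB_acyclic) xu _; exact: mu_rel_kuenneth0 (muP t).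
Qed.
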